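(* Let $\mathcal{V}$ be a group variety defined by a computably enumerable set of laws. A recursively presented marked group $(H,S)$ with $H\in\mathcal{V}$ admits a marked quotient algorithm relative to $\mathcal{V}$ if and only if it is finitely presented modulo $\mathcal{V}$. Moreover this statement is uniform: the numbering $\nu_{FP}^{\mathcal{V}}$ associated to finite presentations modulo $\mathcal{V}$ is equivalent to the conjunction $\nu_{RP}\wedge\nu_{MQA}^{\mathcal{V}}$.
   Context: A $k$-marked group is a pair $(G,S)$ with $G$ a group and $S=(s_1,\dots,s_k)\in G^k$ a tuple generating $G$. A morphism $(G,S)\to(H,S')$ of $k$-marked groups is a group homomorphism sending $s_i$ to $s_i'$ for each $i$; marked groups are considered up to isomorphism of marked groups. $(H,S')$ is a marked quotient of $(G,S)$ if there is a morphism $(G,S)\to(H,S')$. A marked group is said to be in $\mathcal{V}$ if its underlying group is. A subnumbering of a set $X$ is a map $\nu$ from a subset $\mathrm{dom}(\nu)\subseteq\mathbb{N}$ to $X$. $\nu\le\mu$ means that there is a partial computable $F$ defined on $\mathrm{dom}(\nu)$ with $F(p)\in\mathrm{dom}(\mu)$ and $\mu(F(p))=\nu(p)$ for all $p\in\mathrm{dom}(\nu)$; $\nu$ and $\mu$ are equivalent if $\nu\le\mu$ and $\mu\le\nu$. Let $\langle n,m\rangle$ be a computable bijection $\mathbb{N}^2\to\mathbb{N}$ with computable inverse. The conjunction $\nu\wedge\mu$ has domain $\{\langle p,q\rangle:p\in\mathrm{dom}(\nu),q\in\mathrm{dom}(\mu),\nu(p)=\mu(q)\}$ and $(\nu\wedge\mu)(\langle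 p,q\rangle)=\nu(p)$. Let $\mathcal{A}_n=\{x_1,\dots,x_n\}$, $\theta_n:\mathbb{N}\to(\mathcal{A}_n\cup\mathcal{A}_n^{-1})^*$ a natural computable bijection uniformly in $n\ge1$, $\Delta$ the standard numbering of finite subsets of $\mathbb{N}$, $\varphi_0,\varphi_1,\dots$ a standard enumeration of the partial computable functions, $W_i=\mathrm{dom}(\varphi_i)$. Presentations on $\mathcal{A}_n$ define groups marked by $(x_1,\dots,x_n)$. Put $\nu_{RP}(\langle n,i\rangle)=\langle\mathcal{A}_n\mid\theta_n(W_i)\rangle$; a marked group is recursively presented if it is in the image of $\nu_{RP}$. A $k$-marked group $(G,S)$ has a marked quotient algorithm relative to $\mathcal{V}$ if there is an algorithm that takes as input recursive presentations of marked groups in $\mathcal{V}$ and stops exactly on those that define marked quotients of $(G,S)$; i.e. there is $i$ such that for every $j$ with $\nu_{RP}(\langle k,j\rangle)$ in $\mathcal{V}$: $j\in W_i$ if and only if $\nu_{RP}(\langle k,j\rangle)$ is a marked quotient of $(G,S)$. The subnumbering $\nu_{MQA}^{\mathcal{V}}$ of the recursively presented marked groups in $\mathcal{V}$ maps $\langle k,i\rangle$ to the (unique, if it exists) recursively presented $k$-marked group $(G,S)$ in $\mathcal{V}$ for which this holds with index $i$. A finite presentation modulo $\mathcal{V}$ is a presentation consisting of finitely many generators and finitely many relations, together with all the relations given by the laws of $\mathcal{V}$; a marked group in $\mathcal{V}$ is finitely presented modulo $\mathcal{V}$ if it has such a presentation on its marking. $\nu_{FP}^{\mathcal{V}}(\langle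 n,m\rangle)$ is the largest quotient in $\mathcal{V}$ of $\langle\mathcal{A}_n\mid\theta_n(\Delta(m))\rangle$, marked by the images of $x_1,\dots,x_n$. *)

(* Defs.v *)
From Stdlib Require Cantor.
From HB Require Import structures.
From mathcomp Require Import all_boot.
From mathcomp Require Import generic_quotient.
From mathcomp Require Import boolp.
From mathcomp Require Import zify.

Set Implicit Arguments.
Unset Strict Implicit.
Unset Printing Implicit Defensive.

Definition pair_nat (n m : nat) : nat := Cantor.to_nat (n, m).
Definition unpair_nat (p : nat) : nat * nat := Cantor.of_nat p.

Lemma pair_natK n m : unpair_nat (pair_nat n m) = (n, m).
Proof. exact: Cantor.cancel_of_to. Qed.

Lemma unpair_natK p : pair_nat (unpair_nat p).1 (unpair_nat p).2 = p.
Proof.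
by rewrite /pair_nat /unpair_nat -surjective_pairing Cantor.cancel_to_of.
Qed.

(* Kleene's mu-recursive functions in their unary form: several arguments are
   passed as one number through the pairing. *)
Inductive rec_code : Type :=
  | RZero
  | RSucc
  | RFst
  | RSnd
  | RPair of rec_code & rec_code
  | RComp of rec_code & rec_code
  | RPrec of rec_code & rec_code
  | RMu of rec_code.

(* [rec_eval c x y] : the partial function of [c] is defined at [x], with value
   [y].  Writing {c} for this function,
     {RPrec f g}<a, 0> = {f} a,
     {RPrec f g}<a, n+1> = {g}<a, <n, {RPrec f g}<a, n>>>,
     {RMu f} x = the y such that {f}<x, y> = 0 while {f}<x, z> is defined and
                 nonzero for all z < y. *)
Fixpoint rec_eval (c : rec_code) : nat -> nat -> Prop :=
  match c with
  | RZero => fun _ y => y = 0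
  | RSucc => fun x y => y = x.+1
  | RFst => fun x y => y = (unpair_nat x).1
  | RSnd => fun x y => y = (unpair_nat x).2
  | RPair f g => fun x y => exists a b,
      [/\ rec_eval f x a, rec_eval g x b & y = pair_nat a b]
  | RComp f g => fun x y => exists2 z, rec_eval g x z & rec_eval f z y
  | RPrec f g => fun x =>
      let a := (unpair_nat x).1 in
      (fix iter_prec (n : nat) : nat -> Prop :=
         match n with
         | 0 => rec_eval f a
         | m.+1 => fun y => exists2 z,
             iter_prec m z & rec_eval g (pair_nat a (pair_nat m z)) y
         end) (unpair_nat x).2
  | RMu f => fun x y =>
      rec_eval f (pair_nat x y) 0 /\
      forall z, z < y -> exists v, rec_eval f (pair_nat x z) v.+1
  end.

Fixpoint goedel (c : rec_code) : nat :=
  match c with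
  | RZero => 0
  | RSucc => 1
  | RFst => 2
  | RSnd => 3
  | RPair f g => (4 * pair_nat (goedel f) (goedel g)).+4
  | RComp f g => (4 * pair_nat (goedel f) (goedel g)).+4.+1
  | RPrec f g => (4 * pair_nat (goedel f) (goedel g)).+4.+2
  | RMu f => (4 * goedel f).+4.+3
  end.

(* [phi i] is the graph of the [i]-th partial computable function. *)
Definition phi (i x y : nat) : Prop :=
  exists2 c, goedel c = i & rec_eval c x y.

Definition W (i x : nat) : Prop := exists y, phi i x y.

(* Canonical indices: [m] is the sum of the [2 ^ x] for [x] in [Delta m]. *)
Definition Delta (m x : nat) : bool := odd (m %/ 2 ^ x).

Lemma pair_nat_inj a b c d : pair_nat a b = pair_nat c d -> a = c /\ b = d.
Proof. by move=> /(congr1 unpair_nat); rewrite !pair_natK => -[-> ->]. Qed.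

Lemma leq_pair_nat a b : a + b <= pair_nat a b.
Proof. by have := Cantor.to_nat_non_decreasing a b; rewrite /pair_nat; lia. Qed.

Lemma goedel_inj : injective goedel.
Proof.
elim=> [||||f IHf g IHg|f IHf g IHg|f IHf g IHg|f IHf]
  [||||f' g'|f' g'|f' g'|f'] //= E; try lia.
- by have [|/IHf-> /IHg->] := @pair_nat_inj (goedel f) (goedel g)
    (goedel f') (goedel g'); first lia.
- by have [|/IHf-> /IHg->] := @pair_nat_inj (goedel f) (goedel g)
    (goedel f') (goedel g'); first lia.
- by have [|/IHf-> /IHg->] := @pair_nat_inj (goedel f) (goedel g)
    (goedel f') (goedel g'); first lia.
- by rewrite (IHf f') //; lia.
Qed.

Lemma goedel_surj i : exists c, goedel c = i.
Proof.
have [n] := ubnP i; elim: n i => // n IHn i ltin.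
case: (ltnP i 4) => [|le4i].
  case: i {ltin} => [|[|[|[|i]]]] // _; [exists RZero | exists RSucc
    | exists RFst | exists RSnd] => //.
pose q := (i - 4) %/ 4.
have Ei : i = (4 * q).+4 + (i - 4) %% 4 by rewrite /q; lia.
have ltr : (i - 4) %% 4 < 4 by rewrite ltn_pmod.
have le12 := leq_pair_nat (unpair_nat q).1 (unpair_nat q).2.
rewrite unpair_natK in le12.
have [f Ef] : exists c, goedel c = (unpair_nat q).1 by apply: IHn; lia.
have [g Eg] : exists c, goedel c = (unpair_nat q).2 by apply: IHn; lia.
have [h Eh] : exists c, goedel c = q by apply: IHn; lia.
move: ltr Ei; case: (_ %% 4) => [|[|[|[|//]]]] _ ->.
- by exists (RPair f g) => /=; rewrite Ef Eg unpair_natK; lia.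
- by exists (RComp f g) => /=; rewrite Ef Eg unpair_natK; lia.
- by exists (RPrec f g) => /=; rewrite Ef Eg unpair_natK; lia.
- by exists (RMu h) => /=; rewrite Eh; lia.
Qed.

Lemma rec_eval_fun c x y z : rec_eval c x y -> rec_eval c x z -> y = z.
Proof.
elim: c x y z => [||||f IHf g IHg|f IHf g IHg|f IHf g IHg|f IHf] x y z /=;
  try by move=> -> ->.
- move=> [a [b [fa gb ->]]] [a' [b' [fa' gb' ->]]].
  by rewrite (IHf _ _ _ fa fa') (IHg _ _ _ gb gb').
- by move=> [a ga fa] [b /(IHg _ _ _ ga)<-]; apply: IHf.
- elim: (unpair_nat x).2 y z => [|n IHn] y z; first exact: IHf.
  by move=> [a na ga] [b /(IHn _ _ na)<-]; apply: IHg.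
- move=> [fy0 ley] [fz0 lez].
  case: (ltngtP y z) => // [/lez|/ley] [v fv].
    by have := IHf _ _ _ fv fy0.
  by have := IHf _ _ _ fv fz0.
Qed.

Lemma phi_fun i x y z : phi i x y -> phi i x z -> y = z.
Proof. by move=> [c <- cxy] [d /goedel_inj-> ]; apply: rec_eval_fun. Qed.

(* Words over [x_0^{+-1}, ..., x_{n-1}^{+-1}]; the letter [(i, true)] is the
   formal inverse of [(i, false)]. *)
Definition word (n : nat) : Type := seq ('I_n * bool).

(* The inverse of [theta_n], by bijective base-[2n] numeration: for a set [A]
   of numbers, [theta_n(A)] is the set of words [w] with [word_num w] in [A]. *)
Definition word_num n (w : word n) : nat :=
  foldr (fun (l : 'I_n * bool) c => c * n.*2 + (l.1.*2 + l.2).+1) 0 w.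

Lemma word_num_inj n : injective (@word_num n).
Proof.
elim=> [|[i b] w IHw] [|[j c] v] //=; rewrite ?addnS // => -[E].
have lti := ltn_ord i; have ltj := ltn_ord j.
have lt1 : i.*2 + b < n.*2 by case: b {E}; lia.
have lt2 : j.*2 + c < n.*2 by case: c {E}; lia.
have Ed := congr1 (fun m => m %/ n.*2) E; have Em := congr1 (modn^~ n.*2) E.
rewrite /= !divnMDl ?(divn_small lt1) ?(divn_small lt2) ?addn0 in Ed; try lia.
rewrite /= !modnMDl (modn_small lt1) (modn_small lt2) in Em.
rewrite (IHw _ Ed); congr (_ :: _); have Eb : b = c.
  by have := congr1 odd Em; rewrite !oddD !odd_double; case: b {E Em lt1};
     case: c {lt2}.
by subst c; congr (_, _); apply/val_inj => /=; lia.
Qed.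

Lemma word_num_surj n : 0 < n -> forall t, exists w : word n, word_num w = t.
Proof.
move=> n0 t; have [m] := ubnP t; elim: m t => // m IHm [|t] ltt.
  by exists [::].
have ltq : t %/ n.*2 < m by have := leq_div t n.*2; lia.
have [w Ew] := IHm _ ltq.
have ltr : t %% n.*2 < n.*2 by rewrite ltn_pmod; lia.
have lti : (t %% n.*2)./2 < n by lia.
exists ((Ordinal lti, odd (t %% n.*2)) :: w) => /=; rewrite Ew.
have := odd_double_half (t %% n.*2); have := divn_eq t n.*2; lia.
Qed.

Local Open Scope group_scope.
Local Open Scope quotient_scope.

Definition word_val (G : groupType) n (s : 'I_n -> G) (w : word n) : G :=
  \prod_(l <- w) (if l.2 then (s l.1)^-1 else s l.1).

Definition inv_word n (w : word n) : word n :=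
  rev [seq (l.1, ~~ l.2) | l <- w].

Definition subst_word m n (u : 'I_m -> word n) (w : word m) : word n :=
  flatten [seq if l.2 then inv_word (u l.1) else u l.1 | l <- w].

Definition generates (G : groupType) (S : seq G) : Prop :=
  forall P : {pred G}, group_closed P -> {subset S <= P} -> forall g, g \in P.

(* A [k]-marked group is one whose [marking] has size [k].  The choice structure
   carried by a [groupType] is no restriction, classical choice being assumed. *)
Record markedGroup := MarkedGroup {
  mgroup :> groupType;
  marking : seq mgroup;
  marking_generates : generates marking
}.

(* Since [map] preserves sizes, a morphism can only relate groups marked by
   the same number of elements. *)
Definition marked_quotient (G H : markedGroup) : Prop :=
  exists f : {multiplicative G -> H}, map f (marking G) = marking H.

Definition marked_iso (G H : markedGroup) : Prop :=
  exists f : {multiplicative G -> H},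
    map f (marking G) = marking H /\ bijective f.

Section Presentation.
Variables (n : nat) (R : word n -> Prop).

(* Equality of words in the group generated by [x_0, ..., x_{n-1}] subject to
   the relators in [R]. *)
Inductive pres_eq : word n -> word n -> Prop :=
  | pres_refl u : pres_eq u u
  | pres_sym u v : pres_eq u v -> pres_eq v u
  | pres_trans u v w : pres_eq u v -> pres_eq v w -> pres_eq u w
  | pres_cat u u' v v' : pres_eq u u' -> pres_eq v v' ->
      pres_eq (u ++ v) (u' ++ v')
  | pres_cancel i b : pres_eq [:: (i, b); (i, ~~ b)] [::]
  | pres_rel r : R r -> pres_eq r [::].

Definition pres_eqb : rel (word n) := fun u v => `[< pres_eq u v >].

Lemma pres_eqb_equiv : equiv_class_of pres_eqb.
Proof.
split=> [u|u v|v u w]; first exact/asboolP/pres_refl.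
  by apply/asboolP/asboolP; apply: pres_sym.
by move=> /asboolP uv /asboolP vw; apply/asboolP/(pres_trans uv).
Qed.

Canonical pres_equiv := EquivRelPack pres_eqb_equiv.

Definition presented : Type := {eq_quot pres_equiv}.
HB.instance Definition _ := Choice.on presented.

Definition pres_class (w : word n) : presented := \pi_{eq_quot pres_equiv} w.
Definition pres_repr (g : presented) : word n := repr g.

Lemma pres_reprK g : pres_class (pres_repr g) = g.
Proof. exact: reprK. Qed.

Lemma pres_classP u v : pres_class u = pres_class v <-> pres_eq u v.
Proof.
split=> [/eqmodP/asboolP //|uv]; exact/eqmodP/asboolP.
Qed.

Lemma inv_word_cat (u v : word n) :
  inv_word (u ++ v) = inv_word v ++ inv_word u.
Proof. by rewrite /inv_word map_cat rev_cat. Qed.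

Lemma inv_wordK : involutive (@inv_word n).
Proof.
move=> w; rewrite /inv_word map_rev revK -map_comp -[RHS]map_id.
by apply: eq_map => -[i b] /=; rewrite negbK.
Qed.

Lemma pres_mulwV w : pres_eq (w ++ inv_word w) [::].
Proof.
elim: w => [|[i b] w IHw]; first exact: pres_refl.
rewrite -cat1s inv_word_cat.
have -> : ([:: (i, b)] ++ w) ++ inv_word w ++ inv_word [:: (i, b)] =
  ([:: (i, b)] ++ (w ++ inv_word w)) ++ [:: (i, ~~ b)] by rewrite -!catA.
apply: pres_trans (pres_cancel i b).
exact: (pres_cat (pres_cat (pres_refl [:: (i, b)]) IHw) (pres_refl [:: _])).
Qed.

Lemma pres_mulVw w : pres_eq (inv_word w ++ w) [::].
Proof. by rewrite -{2}[w]inv_wordK; apply: pres_mulwV. Qed.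

Lemma pres_inv u v : pres_eq u v -> pres_eq (inv_word u) (inv_word v).
Proof.
move=> uv; rewrite -[inv_word u]cats0.
apply: pres_trans (pres_cat (pres_refl _) (pres_sym (pres_mulwV v))) _.
rewrite catA -[X in pres_eq _ X]cat0s.
apply: pres_cat; last exact: pres_refl.
apply: pres_trans (pres_mulVw u).
by apply: pres_cat; [apply: pres_refl | apply: pres_sym].
Qed.

Definition pres_one : presented := pres_class [::].
Definition pres_mulg (g h : presented) : presented :=
  pres_class (pres_repr g ++ pres_repr h).
Definition pres_invg (g : presented) : presented :=
  pres_class (inv_word (pres_repr g)).

Lemma pres_repr_class w : pres_eq (pres_repr (pres_class w)) w.
Proof. by apply/pres_classP; rewrite pres_reprK. Qed.

Lemma pres_class_mul u v :
  pres_mulg (pres_class u) (pres_class v) = pres_class (u ++ v).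
Proof. by apply/pres_classP/pres_cat; apply: pres_repr_class. Qed.

Lemma pres_class_inv u : pres_invg (pres_class u) = pres_class (inv_word u).
Proof. by apply/pres_classP/pres_inv; apply: pres_repr_class. Qed.

Lemma pres_mulgA : associative pres_mulg.
Proof.
move=> x y z; rewrite -(pres_reprK x) -(pres_reprK y) -(pres_reprK z).
by rewrite !pres_class_mul catA.
Qed.

Lemma pres_mul1g : left_id pres_one pres_mulg.
Proof. by move=> x; rewrite -(pres_reprK x) pres_class_mul. Qed.

Lemma pres_mulg1 : right_id pres_one pres_mulg.
Proof. by move=> x; rewrite -(pres_reprK x) pres_class_mul cats0. Qed.

Lemma pres_mulVg : left_inverse pres_one pres_invg pres_mulg.
Proof.
move=> x; rewrite -(pres_reprK x) pres_class_inv pres_class_mul.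
exact/pres_classP/pres_mulVw.
Qed.

Lemma pres_mulgV : right_inverse pres_one pres_invg pres_mulg.
Proof.
move=> x; rewrite -(pres_reprK x) pres_class_inv pres_class_mul.
exact/pres_classP/pres_mulwV.
Qed.

HB.instance Definition _ := isGroup.Build presented
  pres_mulgA pres_mul1g pres_mulg1 pres_mulVg pres_mulgV.

Definition pres_gen (i : 'I_n) : presented := pres_class [:: (i, false)].

Lemma pres_classM u v : pres_class (u ++ v) = pres_class u * pres_class v.
Proof. by rewrite -pres_class_mul. Qed.

Lemma pres_classV u : pres_class (inv_word u) = (pres_class u)^-1.
Proof. by rewrite -pres_class_inv. Qed.

Lemma word_val_pres_gen w : word_val pres_gen w = pres_class w.
Proof.
rewrite /word_val; elim: w => [|[i b] w IHw]; first by rewrite big_nil.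
rewrite big_cons IHw -cat1s pres_classM; congr (_ * _).
by case: b => //=; rewrite -pres_classV.
Qed.

Lemma pres_generates : generates [seq pres_gen i | i <- enum 'I_n].
Proof.
move=> P Pgrp sP g; rewrite -(pres_reprK g).
have PV := group_closedV Pgrp; have PM := group_closedM Pgrp.
elim: (pres_repr g) => [|[i b] w IHw]; first exact: Pgrp.1.
have Pi : pres_gen i \in P by apply/sP/map_f; rewrite mem_enum.
rewrite -cat1s pres_classM; apply: PM IHw; case: b => //.
by rewrite (_ : pres_class _ = (pres_gen i)^-1) ?PV // -pres_classV.
Qed.

Definition pres : markedGroup := MarkedGroup pres_generates.

End Presentation.

(* A law in [n] variables is a word [l], understood as the identity [l = 1]. *)
Definition satisfies (G : groupType) n (l : word n) : Prop :=
  forall s : 'I_n -> G, word_val s l = 1.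

Definition laws : Type := forall n, word n -> Prop.

Definition variety (L : laws) (G : groupType) : Prop :=
  forall n (l : word n), L n l -> satisfies G l.

Definition ce_laws (L : laws) : Prop :=
  exists e, forall n (l : word n), L n l <-> W e (pair_nat n (word_num l)).

Definition law_of (V : groupType -> Prop) n (l : word n) : Prop :=
  forall G : groupType, V G -> satisfies G l.

(* The relations on [n] generators given by the laws of [V]: all values of these
   laws in words. *)
Definition law_relation (V : groupType -> Prop) n (w : word n) : Prop :=
  exists m (l : word m) (u : 'I_m -> word n), law_of V l /\ w = subst_word u l.

Definition fin_presented_mod (V : groupType -> Prop) (G : markedGroup) : Prop :=
  exists n (R : seq (word n)),
    marked_iso (pres (fun w => w \in R \/ law_relation V w)) G.

Definition largest_quotient (V : groupType -> Prop) (G Q : markedGroup) : Prop :=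
  [/\ V Q, marked_quotient G Q &
      forall Q' : markedGroup,
        V Q' -> marked_quotient G Q' -> marked_quotient Q Q'].

Lemma word_val_cat (G : groupType) n (s : 'I_n -> G) u v :
  word_val s (u ++ v) = word_val s u * word_val s v.
Proof. by rewrite /word_val big_cat. Qed.

Lemma word_val_morph (G H : groupType) (f : {multiplicative G -> H}) n
  (s : 'I_n -> G) w : word_val (f \o s) w = f (word_val s w).
Proof.
have f1 : f 1 = 1 by apply: (mulgI (f 1)); rewrite -gmulfM !mulg1.
have fV x : f x^-1 = (f x)^-1.
  by apply: (mulgI (f x)); rewrite -gmulfM !mulgV.
rewrite /word_val; elim: w => [|[i b] w IHw]; first by rewrite !big_nil.
by rewrite !big_cons IHw gmulfM; case: b => /=; rewrite ?fV.
Qed.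

Lemma word_val_pres_eq (G : groupType) n (R : word n -> Prop) (s : 'I_n -> G) :
    (forall r, R r -> word_val s r = 1) ->
  forall u v, pres_eq R u v -> word_val s u = word_val s v.
Proof.
move=> sR u v; elim=> {u v} // [u v w _ -> _ ->|u u' v v' _ Eu _ Ev|i b|r /sR->].
- by [].
- by rewrite !word_val_cat Eu Ev.
- by rewrite /word_val !big_cons big_nil; case: b; rewrite /= mulg1 ?mulgV ?mulVg.
- by rewrite /word_val big_nil.
Qed.

Lemma pres_morph (G : groupType) n (R : word n -> Prop) (s : 'I_n -> G) :
    (forall r, R r -> word_val s r = 1) ->
  exists f : {multiplicative pres R -> G}, forall i, f (pres_gen R i) = s i.
Proof.
move=> sR; pose f (g : pres R) := word_val s (pres_repr g).
have fE w : f (pres_class R w) = word_val s w.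
  exact/(word_val_pres_eq sR)/pres_repr_class.
have fM : {morph f : x y / x * y}.
  move=> x y; rewrite -(pres_reprK x) -(pres_reprK y) -pres_classM !fE.
  exact: word_val_cat.
pose F := Multiplicative.Pack (Multiplicative.Class
  (isMultiplicative.Build _ _ f fM)).
by exists F => i; rewrite /= fE /word_val big_cons big_nil mulg1.
Qed.

Lemma word_val_subst (G : groupType) m n (s : 'I_n -> G) (u : 'I_m -> word n) l :
  word_val s (subst_word u l) = word_val (fun i => word_val s (u i)) l.
Proof.
have sV (w : word n) : word_val s (inv_word w) = (word_val s w)^-1.
  have E : word_val s (inv_word w ++ w) = word_val s [::].
    apply: (@word_val_pres_eq _ _ (fun=> False)) => //; exact: pres_mulVw.
  rewrite word_val_cat {3}/word_val big_nil in E.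
  by rewrite -[LHS]mulg1 -(mulgV (word_val s w)) mulgA E mul1g.
elim: l => [|[i b] l IHl]; first by rewrite /subst_word /word_val /= !big_nil.
rewrite /subst_word /= word_val_cat -/(subst_word u l) IHl.
by rewrite [in RHS]/word_val big_cons; case: b; rewrite /= ?sV.
Qed.

Lemma ex_largest_quotient (L : laws) n (R : word n -> Prop) :
  exists Q, largest_quotient (variety L) (pres R) Q.
Proof.
pose V := variety L; pose R' (w : word n) := R w \/ law_relation V w.
have genR' r : R' r -> word_val (pres_gen R') r = 1.
  by move=> R'r; rewrite word_val_pres_gen; apply/pres_classP/pres_rel.
have lift (Q : markedGroup) (f : {multiplicative pres R -> Q}) :
  map f (marking (pres R)) = marking Q ->
  [seq f (pres_gen R i) | i <- enum 'I_n] = marking Q by rewrite -map_comp.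
exists (pres R'); split.
- move=> m l Ll s; have -> : s = fun i => word_val (pres_gen R') (pres_repr (s i)).
    by apply/funext => i; rewrite word_val_pres_gen pres_reprK.
  rewrite -word_val_subst; apply: genR'; right; exists m, l.
  by exists (fun i => pres_repr (s i)); split=> // G; apply.
- have [f fE] := @pres_morph (pres R') n R (pres_gen R') (fun r Rr =>
    genR' r (or_introl Rr)).
  by exists f; rewrite /= -map_comp; apply: eq_map => i /=; rewrite fE.
- move=> Q VQ [f /lift fQ].
  have fR' r : R' r -> word_val (f \o pres_gen R) r = 1.
    case=> [Rr|[m [l [u [Vl ->]]]]]; last by rewrite word_val_subst; apply: Vl.
    have -> : 1 = f 1 by apply: (mulgI (f 1)); rewrite -gmulfM !mulg1.
    rewrite word_val_morph word_val_pres_gen; congr (f _).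
    exact/pres_classP/pres_rel.
  have [g gE] := pres_morph fR'; exists g; rewrite -fQ /= -map_comp.
  by apply: eq_map => i /=; rewrite gE.
Qed.

(* Equality of values is isomorphism of marked groups throughout. *)
Record subnumbering := Subnumbering {
  dom : nat -> Prop;
  nu_val : forall p, dom p -> markedGroup
}.

Definition sub_le (nu mu : subnumbering) : Prop :=
  exists e, forall p (hp : dom nu p), exists q (hq : dom mu q),
    phi e p q /\ marked_iso (nu_val hq) (nu_val hp).

Definition sub_equiv (nu mu : subnumbering) : Prop :=
  sub_le nu mu /\ sub_le mu nu.

Definition conj_dom (nu mu : subnumbering) (r : nat) : Prop :=
  exists (hp : dom nu (unpair_nat r).1) (hq : dom mu (unpair_nat r).2),
    marked_iso (nu_val hp) (nu_val hq).

Definition sub_conj (nu mu : subnumbering) : subnumbering :=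
  {| dom := conj_dom nu mu;
     nu_val := fun r (h : conj_dom nu mu r) =>
       nu_val (let: ex_intro hp _ := h in hp) |}.

Definition rec_pres (n i : nat) : markedGroup :=
  pres (fun w : word n => W i (word_num w)).

(* As [theta_n] is a bijection only for [n >= 1], the numberings by presentations
   are restricted to positive ranks. *)
Definition nu_RP : subnumbering :=
  {| dom := fun p => 0 < (unpair_nat p).1;
     nu_val := fun p _ => rec_pres (unpair_nat p).1 (unpair_nat p).2 |}.

Definition rec_presented (G : markedGroup) : Prop :=
  exists p (hp : dom nu_RP p), marked_iso (nu_val hp) G.

Definition fin_pres (n m : nat) : markedGroup :=
  pres (fun w : word n => Delta m (word_num w)).

Lemma ex_largest_fin_pres (L : laws) n m :
  exists Q, largest_quotient (variety L) (fin_pres n m) Q.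
Proof. exact: ex_largest_quotient. Qed.

Definition nu_FP (L : laws) : subnumbering :=
  {| dom := fun p => 0 < (unpair_nat p).1;
     nu_val := fun p _ => projT1 (cid
       (ex_largest_fin_pres L (unpair_nat p).1 (unpair_nat p).2)) |}.

Definition mqa_index (V : groupType -> Prop) (G : markedGroup) (i : nat) : Prop :=
  let k := size (marking G) in
  forall j, V (rec_pres k j) -> (W i j <-> marked_quotient G (rec_pres k j)).

Definition has_mqa (V : groupType -> Prop) (G : markedGroup) : Prop :=
  exists i, mqa_index V G i.

Definition mqa_graph (V : groupType -> Prop) (p : nat) (G : markedGroup) : Prop :=
  [/\ rec_presented G, V G, size (marking G) = (unpair_nat p).1 &
      mqa_index V G (unpair_nat p).2].

Lemma marked_quotient_antisym (G H : markedGroup) :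
  marked_quotient G H -> marked_quotient H G -> marked_iso G H.
Proof.
have comp_id (A B : markedGroup) (f : {multiplicative A -> B})
    (g : {multiplicative B -> A}) :
  map f (marking A) = marking B -> map g (marking B) = marking A ->
  cancel f g.
  move=> fm gm; pose P : {pred A} := [pred x | g (f x) == x].
  have gf1 : g (f 1) = 1.
    by apply: (mulgI (g (f 1))); rewrite -!gmulfM !mulg1.
  have gfV x : g (f x^-1) = (g (f x))^-1.
    by apply: (mulgI (g (f x))); rewrite -!gmulfM !mulgV gf1.
  have PG : group_closed P.
    split=> [|x y]; rewrite !inE ?gf1 // => /eqP xE /eqP yE.
    by rewrite !gmulfM gfV xE yE.
  have PS : {subset marking A <= P}.
    move=> x xA; rewrite inE /=; move: gm; rewrite -fm -map_comp.
    by rewrite -[RHS]map_id => /eq_in_map/(_ x xA) /= ->.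
  by move=> x; have := marking_generates PG PS x; rewrite inE => /eqP.
move=> [f fm] [g gm]; exists f; split=> //.
by exists g; [apply: comp_id fm gm | apply: comp_id gm fm].
Qed.

Lemma marked_quotient_trans (G H K : markedGroup) :
  marked_quotient G H -> marked_quotient H K -> marked_quotient G K.
Proof.
move=> [f fm] [g gm].
exists (g \o f : {multiplicative G -> K}).
by rewrite map_comp fm gm.
Qed.

Lemma marked_iso_sym (G H : markedGroup) : marked_iso G H -> marked_iso H G.
Proof.
move=> [f [fm [g fK gK]]].
have gM : {morph g : x y / x * y} := can2_gmulfM fK gK.
pose g' : {multiplicative H -> G} := Multiplicative.Pack (Multiplicative.Class
  (isMultiplicative.Build _ _ g gM)).
exists g'; split; last by exists f.
by rewrite -fm -map_comp -[RHS]map_id; apply: eq_map => x /=; rewrite fK.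
Qed.

Lemma marked_iso_quotient (G H : markedGroup) :
  marked_iso G H -> marked_quotient G H.
Proof. by move=> [f [fm _]]; exists f. Qed.

Lemma marked_quotient_size (G H : markedGroup) :
  marked_quotient G H -> size (marking G) = size (marking H).
Proof. by move=> [f <-]; rewrite size_map. Qed.

(* [cid] chooses among marked groups that are all isomorphic when [V] is a
   variety, see [mqa_graph_unique]. *)
Definition nu_MQA (V : groupType -> Prop) : subnumbering :=
  {| dom := fun p => exists G, mqa_graph V p G;
     nu_val := fun p (h : exists G, mqa_graph V p G) => projT1 (cid h) |}.

Lemma variety_iso (L : laws) (G H : markedGroup) :
  marked_iso G H -> variety L G -> variety L H.
Proof.
move=> [f [_ [g fK gK]]] VG n l Ll s.
have f1 : f 1 = 1 by apply: (mulgI (f 1)); rewrite -gmulfM !mulg1.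
have -> : s = f \o (g \o s) by apply/funext => i /=; rewrite gK.
by rewrite word_val_morph (VG n l Ll) f1.
Qed.

Lemma mqa_graph_unique (L : laws) p (G H : markedGroup) :
  mqa_graph (variety L) p G -> mqa_graph (variety L) p H -> marked_iso G H.
Proof.
have half (A B : markedGroup) : mqa_graph (variety L) p A ->
    mqa_graph (variety L) p B -> marked_quotient B A.
  move=> [[q [q0 isoA]] VA szA mqaA] [_ _ szB mqaB].
  have Eq : (unpair_nat q).1 = (unpair_nat p).1.
    rewrite -szA -(marked_quotient_size (marked_iso_quotient isoA)) /=.
    by rewrite size_map -cardE card_ord.
  have VR := variety_iso (marked_iso_sym isoA) VA.
  rewrite /mqa_index szA in mqaA; rewrite /mqa_index szB in mqaB.
  rewrite /= Eq in isoA VR.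
  have /(mqaA _ VR) := marked_iso_quotient (marked_iso_sym isoA).
  move=> /(mqaB _ VR) /marked_quotient_trans; apply.
  exact: marked_iso_quotient.
by move=> pG pH; apply: marked_quotient_antisym; apply: half.
Qed.

(* Main.v *)
(* Both directions rest on the fact that a presentation with relators R together
   with all values of the laws (a c.e. set) defines the largest quotient in V of
   the group presented by R.
   From a finite presentation modulo V: a recursively presented group in V is a
   marked quotient iff the finitely many relators are consequences of its
   relators, which is semi-decidable.
   Conversely, let H in V be presented by W_e and have a marked quotient
   algorithm i.  For x in N let f(x) index the law values together with the
   elements of W_e enumerated while x has not yet been seen in W_x, and let d
   index {x | f(x) in W_i}.  If d were not in W_d, then f(d) would present H and
   i would accept it, so d in W_d after all; hence i accepts f(d), which
   consists of the law values and of finitely many elements of W_e.  So some finite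
   F included in W_e is such that i accepts F modulo V, and then F presents H
   modulo V.  These two properties of F are semi-decidable, so F can be found by
   unbounded search, uniformly in e and i. *)
Require Import Defs.
From HB Require Import structures.
From mathcomp Require Import all_boot.
From mathcomp Require Import boolp zify.

Set Implicit Arguments.
Unset Strict Implicit.
Unset Printing Implicit Defensive.

(** * Computable functions on coded types *)

(** A code is a bijection with [nat]: decoding is then the identity on codes ([comp_dec]), and an
    unbounded search over numbers is a search over the type. *)
HB.mixin Record isCoded (T : Type) := {
  enc : T -> nat;
  dec : nat -> T;
  encK : cancel enc dec;
  decK : cancel dec enc
}.

#[short(type="codedType")]
HB.structure Definition Coded := {T of isCoded T & Equality T}.

Lemma enc_inj (T : codedType) : injective (@enc T).
Proof. exact: can_inj encK. Qed.

HB.instance Definition _ :=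
  @isCoded.Build nat id id (fun=> erefl) (fun=> erefl).

Section ProdCode.
Variables A B : codedType.

Definition prod_enc (p : A * B) : nat := pair_nat (enc p.1) (enc p.2).
Definition prod_dec (k : nat) : A * B :=
  (dec (unpair_nat k).1, dec (unpair_nat k).2).

Lemma prod_encK : cancel prod_enc prod_dec.
Proof. by case=> a b; rewrite /prod_dec pair_natK /= !encK. Qed.

Lemma prod_decK : cancel prod_dec prod_enc.
Proof. by move=> k; rewrite /prod_enc /= !decK unpair_natK. Qed.

HB.instance Definition _ := isCoded.Build (A * B)%type prod_encK prod_decK.

End ProdCode.

Section SeqCode.
Variable T : codedType.

Fixpoint seq_enc (s : seq T) : nat :=
  if s is x :: s' then (pair_nat (enc x) (seq_enc s')).+1 else 0.

Lemma seq_enc_inj : injective seq_enc.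
Proof.
elim=> [|x s IHs] [|y t] //= [] /pair_nat_inj[/enc_inj-> /IHs->] //.
Qed.

Lemma seq_enc_surj k : exists s, seq_enc s = k.
Proof.
have [n] := ubnP k; elim: n k => // n IHn [|k] ltk; first by exists [::].
have := leq_pair_nat (unpair_nat k).1 (unpair_nat k).2.
rewrite unpair_natK => le_k.
have [|s Es] := IHn (unpair_nat k).2; first by lia.
by exists (dec (unpair_nat k).1 :: s); rewrite /= decK Es unpair_natK.
Qed.

(** The inverse is chosen classically; this is harmless, since computability speaks of codes
    only. *)
Definition seq_dec (k : nat) : seq T := projT1 (cid (seq_enc_surj k)).

Lemma seq_decK : cancel seq_dec seq_enc.
Proof. by move=> k; rewrite /seq_dec; case: cid. Qed.

Lemma seq_encK : cancel seq_enc seq_dec.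
Proof. by move=> s; apply: seq_enc_inj; rewrite seq_decK. Qed.

HB.instance Definition _ := isCoded.Build (seq T) seq_encK seq_decK.

End SeqCode.

Definition computable (A B : codedType) (f : A -> B) : Prop :=
  exists c, forall a, rec_eval c (enc a) (enc (f a)).

Definition decidable_pred (A : codedType) (P : A -> bool) : Prop :=
  computable (fun a => nat_of_bool (P a)).

Lemma comp_ext (A B : codedType) (f g : A -> B) :
  f =1 g -> computable f -> computable g.
Proof. by move=> fg [c cP]; exists c => a; rewrite -fg. Qed.

Lemma dec_ext (A : codedType) (f g : A -> bool) : f =1 g -> decidable_pred f ->
  decidable_pred g.
Proof. by move=> fg; apply: comp_ext => a; rewrite fg. Qed.

Lemma comp_id (A : codedType) : computable (fun a : A => a).
Proof.
by exists (RPair RFst RSnd) => a; do 2!eexists; split=> //; rewrite unpair_natK.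
Qed.

Lemma comp_const (A B : codedType) (b : B) : computable (fun _ : A => b).
Proof.
suff [c cP] : exists c, forall x, rec_eval c x (enc b) by exists c.
elim: (enc b) => [|k [c cP]]; first by exists RZero.
by exists (RComp RSucc c) => x; exists k.
Qed.

Lemma comp_comp (A B C : codedType) (g : B -> C) (f : A -> B) :
  computable g -> computable f -> computable (fun a => g (f a)).
Proof. by move=> [d dP] [c cP]; exists (RComp d c) => a;
  exists (enc (f a)). Qed.

Lemma comp_pair (A B C : codedType) (f : A -> B) (g : A -> C) :
  computable f -> computable g -> computable (fun a => (f a, g a)).
Proof.
move=> [c cP] [d dP]; exists (RPair c d) => a.
by exists (enc (f a)), (enc (g a)).
Qed.

Lemma comp_fst (A B C : codedType) (f : A -> B * C) :
  computable f -> computable (fun a => (f a).1).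
Proof.
apply: comp_comp; exists RFst => -[b c] /=.
by rewrite -[enc (b, c)]/(pair_nat _ _) pair_natK.
Qed.

Lemma comp_snd (A B C : codedType) (f : A -> B * C) :
  computable f -> computable (fun a => (f a).2).
Proof.
apply: comp_comp; exists RSnd => -[b c] /=.
by rewrite -[enc (b, c)]/(pair_nat _ _) pair_natK.
Qed.

Lemma comp_enc (A B : codedType) (f : A -> B) :
  computable f -> computable (fun a => enc (f a)).
Proof. by []. Qed.

Lemma comp_dec (A B : codedType) (f : A -> nat) :
  computable f -> computable (fun a => dec (f a) : B).
Proof. by move=> [c cP]; exists c => a; rewrite decK. Qed.

Lemma comp_app2 (A B C D : codedType) (h : B -> C -> D) (f : A -> B)
    (g : A -> C) :
  computable (fun p : B * C => h p.1 p.2) ->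
  computable f -> computable g -> computable (fun a => h (f a) (g a)).
Proof.
by move=> ch cf cg; apply: (comp_comp ch (f := fun a => (f a, g a)));
  apply: comp_pair.
Qed.

Lemma dec_app2 (A B C : codedType) (h : B -> C -> bool) (f : A -> B)
    (g : A -> C) :
  decidable_pred (fun p : B * C => h p.1 p.2) ->
  computable f -> computable g -> decidable_pred (fun a => h (f a) (g a)).
Proof.
by move=> dh cf cg; apply: (comp_app2 (h := fun b c => nat_of_bool (h b c))).
Qed.

Lemma comp_pair_nat (A : codedType) (f g : A -> nat) :
  computable f -> computable g -> computable (fun a => pair_nat (f a) (g a)).
Proof. exact: comp_pair. Qed.

Lemma comp_unpair_nat (A : codedType) (f : A -> nat) :
  computable f -> computable (fun a => unpair_nat (f a)).
Proof.
move=> [c cP]; exists c => a.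
by rewrite -[enc (unpair_nat _)]/(pair_nat _ _) unpair_natK.
Qed.

Lemma comp_succ (A : codedType) (f : A -> nat) :
  computable f -> computable (fun a => (f a).+1).
Proof. by apply: (comp_comp (g := succn)); exists RSucc. Qed.

(** Primitive recursion with parameter [a]. Addition, conditionals, case analysis on lists and folds
    all reduce to it. *)
Lemma comp_iteri (A B : codedType) (n : A -> nat) (h : A -> nat -> B -> B)
    (g : A -> B) :
  computable n -> computable g ->
  computable (fun p : A * (nat * B) => h p.1 p.2.1 p.2.2) ->
  computable (fun a => iteri (n a) (h a) (g a)).
Proof.
move=> [d dP] [c cP] [e eP].
exists (RComp (RPrec c e) (RPair (RPair RFst RSnd) d)) => a.
exists (pair_nat (enc a) (n a)).
  exists (enc a), (n a); split=> //.
  by do 2!eexists; split=> //; rewrite unpair_natK.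
rewrite /= pair_natK /=; elim: (n a) => [|k IHk]; first exact: cP.
exists (enc (iteri k (h a) (g a))) => //.
exact: (eP (a, (k, iteri k (h a) (g a)))).
Qed.

Lemma comp_pred (A : codedType) (f : A -> nat) : computable f ->
  computable (fun a => (f a).-1).
Proof.
move=> cf; apply: (@comp_ext _ _ (fun a => iteri (f a) (fun k _ => k) 0)).
  by move=> a; case: (f a).
apply: comp_iteri => //; first exact: comp_const.
exact/comp_fst/comp_snd/comp_id.
Qed.

Lemma comp_add (A : codedType) (f g : A -> nat) :
  computable f -> computable g -> computable (fun a => f a + g a).
Proof.
move=> cf cg; apply: (@comp_ext _ _ (fun a => iteri (g a)
  (fun _ b => b.+1) (f a))).
  by move=> a; elim: (g a) => [|n /= ->]; rewrite ?addn0 ?addnS.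
by apply: comp_iteri => //; apply/comp_succ/comp_snd/comp_snd/comp_id.
Qed.

Lemma comp_sub (A : codedType) (f g : A -> nat) :
  computable f -> computable g -> computable (fun a => f a - g a).
Proof.
move=> cf cg; apply: (@comp_ext _ _ (fun a => iteri (g a)
  (fun _ b => b.-1) (f a))).
  by move=> a; elim: (g a) => [|n /= ->]; rewrite ?subn0 ?subnS.
by apply: comp_iteri => //; apply/comp_pred/comp_snd/comp_snd/comp_id.
Qed.

Lemma comp_mul (A : codedType) (f g : A -> nat) :
  computable f -> computable g -> computable (fun a => f a * g a).
Proof.
move=> cf cg.
apply: (@comp_ext _ _ (fun a => iteri (g a) (fun _ b => b + f a) 0)).
  by move=> a; elim: (g a) => [|n /= ->]; rewrite ?muln0 ?mulnSr.
apply: comp_iteri => //; first exact: comp_const.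
apply: comp_add; first exact/comp_snd/comp_snd/comp_id.
exact/(comp_comp cf)/comp_fst/comp_id.
Qed.

Lemma dec_eq0 (A : codedType) (f : A -> nat) : computable f ->
  decidable_pred (fun a => f a == 0).
Proof.
move=> cf; apply: (@comp_ext _ _ (fun a => iteri (f a) (fun _ _ => 0) 1)).
  by move=> a; case: (f a).
by apply: comp_iteri => //; apply: comp_const.
Qed.

Lemma comp_nat_of_bool (A : codedType) (P : A -> bool) : decidable_pred P ->
  computable (fun a => nat_of_bool (P a)).
Proof. by []. Qed.

Lemma comp_if (A B : codedType) (P : A -> bool) (f g : A -> B) :
  decidable_pred P -> computable f -> computable g ->
  computable (fun a => if P a then f a else g a).
Proof.
move=> dP cf cg.
apply: (@comp_ext _ _ (fun a => iteri (P a) (fun _ _ => f a) (g a))).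
  by move=> a; case: (P a).
by apply: comp_iteri => //; apply/(comp_comp cf)/comp_fst/comp_id.
Qed.

Lemma dec_if (A : codedType) (P Q1 Q2 : A -> bool) : decidable_pred P ->
  decidable_pred Q1 -> decidable_pred Q2 ->
  decidable_pred (fun a => if P a then Q1 a else Q2 a).
Proof.
move=> dP d1 d2; have := comp_if dP d1 d2.
by apply: comp_ext => a; case: (P a).
Qed.

Lemma dec_const (A : codedType) b : decidable_pred (fun _ : A => b).
Proof. exact: comp_const. Qed.

Lemma dec_neg (A : codedType) (P : A -> bool) : decidable_pred P ->
  decidable_pred (fun a => ~~ P a).
Proof. by move=> dP; apply: dec_if => //; apply: dec_const. Qed.

Lemma dec_and (A : codedType) (P Q : A -> bool) : decidable_pred P ->
  decidable_pred Q -> decidable_pred (fun a => P a && Q a).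
Proof. by move=> dP dQ; apply: dec_if => //; apply: dec_const. Qed.

Lemma dec_or (A : codedType) (P Q : A -> bool) : decidable_pred P ->
  decidable_pred Q -> decidable_pred (fun a => P a || Q a).
Proof. by move=> dP dQ; apply: dec_if => //; apply: dec_const. Qed.

Lemma dec_leq (A : codedType) (f g : A -> nat) :
  computable f -> computable g -> decidable_pred (fun a => f a <= g a).
Proof. by move=> cf cg; apply/dec_eq0/comp_sub. Qed.

Lemma dec_eq (A B : codedType) (f g : A -> B) :
  computable f -> computable g -> decidable_pred (fun a => f a == g a).
Proof.
move=> cf cg; apply: (@dec_ext _
    (fun a => (enc (f a) <= enc (g a)) && (enc (g a) <= enc (f a)))).
  by move=> a; rewrite -eqn_leq (inj_eq (@enc_inj B)).
by apply: dec_and; apply: dec_leq.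
Qed.

Lemma dec_odd (A : codedType) (f : A -> nat) : computable f ->
  decidable_pred (fun a => odd (f a)).
Proof.
move=> cf; apply: (@comp_ext _ _ (fun a => iteri (f a) (fun _ b => 1 - b) 0)).
  by move=> a; elim: (f a) => //= n ->; case: odd.
apply: comp_iteri => //; first exact: comp_const.
apply: comp_sub; first exact: comp_const.
exact/comp_snd/comp_snd/comp_id.
Qed.

Lemma comp_half (A : codedType) (f : A -> nat) : computable f ->
  computable (fun a => (f a)./2).
Proof.
move=> cf.
apply: (@comp_ext _ _ (fun a => iteri (f a) (fun k b => odd k + b) 0)).
  by move=> a; elim: (f a) => //= n ->; lia.
apply: comp_iteri => //; first exact: comp_const.
apply: comp_add; last exact/comp_snd/comp_snd/comp_id.
exact/dec_odd/comp_fst/comp_snd/comp_id.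
Qed.

Lemma comp_cons (A T : codedType) (x : A -> T) (s : A -> seq T) :
  computable x -> computable s -> computable (fun a => x a :: s a).
Proof.
(* By definition of [seq_enc], the code of a nonempty list is the successor of the code of the pair
   formed by its head and tail. *)
move=> cx cs; pose g a := (enc (x a, s a)).+1.
have [c cP] : computable g by apply/comp_succ/comp_enc/comp_pair.
by exists c.
Qed.

(** The loop runs [enc (s a)] times and each round forgets the previous one. The last round has
    index [enc (s a) - 1], which is the code of the pair of head and tail; for the empty list there
    is no round at all. *)
Lemma comp_case_seq (A T B : codedType) (s : A -> seq T) (g : A -> B)
    (h : A -> T -> seq T -> B) :
  computable s -> computable g ->
  computable (fun p : A * (T * seq T) => h p.1 p.2.1 p.2.2) ->
  computable (fun a => if s a is x :: r then h a x r else g a).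
Proof.
move=> cs cg ch.
pose h' (p : A * (nat * B)) :=
  (fun q : A * (T * seq T) => h q.1 q.2.1 q.2.2) (p.1, dec p.2.1).
apply: (@comp_ext _ _ (fun a => iteri (enc (s a))
  (fun k b => h' (a, (k, b))) (g a))).
  move=> a; case: (s a) => //= x r.
  by rewrite -[h a x r]/(h a (x, r).1 (x, r).2) -(encK (x, r)).
apply: comp_iteri => //; apply: (comp_comp ch).
apply: comp_pair; first exact/comp_fst/comp_id.
exact/comp_dec/comp_fst/comp_snd/comp_id.
Qed.

Lemma leq_size_enc (T : codedType) (s : seq T) : size s <= enc s.
Proof.
elim: s => //= x s IHs; rewrite ltnS (leq_trans IHs) //.
exact: leq_trans (leq_addl _ _) (leq_pair_nat (enc x) (enc s)).
Qed.

Lemma comp_iter (A B : codedType) (n : A -> nat) (h : A -> B -> B) (g : A ->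
  B) :
  computable n -> computable g ->
  computable (fun p : A * B => h p.1 p.2) ->
  computable (fun a => iter (n a) (h a) (g a)).
Proof.
move=> cn cg ch.
apply: (@comp_ext _ _ (fun a => iteri (n a) (fun=> h a) (g a))).
  by move=> a; elim: (n a) => //= k ->.
apply: comp_iteri => //; apply: (comp_comp ch (f := fun p => (p.1, p.2.2))).
by apply: comp_pair; [apply/comp_fst/comp_id | apply/comp_snd/comp_snd/comp_id].
Qed.

(** The loop state is the accumulator with the remaining list, and it is stationary once that list
    is empty. So any number of rounds not below the length will do, such as the code of the list
    ([leq_size_enc]). *)
Lemma comp_foldl (A B T : codedType) (s : A -> seq T) (g : A -> B)
    (h : A -> B -> T -> B) :
  computable s -> computable g ->
  computable (fun p : A * (B * T) => h p.1 p.2.1 p.2.2) ->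
  computable (fun a => foldl (h a) (g a) (s a)).
Proof.
move=> cs cg ch.
pose step a (p : B * seq T) :=
  if p.2 is x :: r then (h a p.1 x, r) else (p.1, [::]).
apply: (@comp_ext _ _ (fun a => (iter (enc (s a)) (step a) (g a, s a)).1)).
  move=> a; have := leq_size_enc (s a);
    elim: (s a) (g a) (enc _) => [|x r IHr] b n.
    by move=> _; rewrite (_ : iter n _ _ = (b, [::])) //; elim: n => //= n ->.
  by case: n => // n len; rewrite iterSr /= IHr.

apply/comp_fst/comp_iter; [exact: comp_enc | exact: comp_pair |].
apply: (comp_case_seq (s := fun p : A * (B * seq T) => p.2.2)
  (h := fun p x r => (h p.1 p.2.1 x, r))).
- exact/comp_snd/comp_snd/comp_id.
- by apply: comp_pair; [apply/comp_fst/comp_snd/comp_id | apply: comp_const].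
apply: comp_pair; last exact/comp_snd/comp_snd/comp_id.
apply: (comp_comp ch (f := fun p => (p.1.1, (p.1.2.1, p.2.1)))).
apply: comp_pair; first exact/comp_fst/comp_fst/comp_id.
apply: comp_pair; first exact/comp_fst/comp_snd/comp_fst/comp_id.
exact/comp_fst/comp_snd/comp_id.
Qed.

Lemma comp_double (A : codedType) (f : A -> nat) :
  computable f -> computable (fun a => (f a).*2).
Proof.
move=> cf; apply: (@comp_ext _ _ (fun a => f a + f a)); last exact: comp_add.
by move=> a; rewrite addnn.
Qed.

(** Syntax-directed use of the closure lemmas; [base] is tried before them and supplies the rules
    for further operations. *)
Ltac computability_with base :=
  repeat first
    [ assumption | base
    | lazymatch goal with
      | |- decidable_pred (fun a => ~~ _) => apply: dec_neg
      | |- decidable_pred (fun a => _ && _) => apply: dec_and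
      | |- decidable_pred (fun a => _ || _) => apply: dec_or
      | |- decidable_pred (fun a => _ <= _) => apply: dec_leq
      | |- decidable_pred (fun a => _ == _) => apply: dec_eq
      | |- decidable_pred (fun a => odd _) => apply: dec_odd
      | |- decidable_pred (fun a => if _ then _ else _) => apply: dec_if
      | |- computable (fun a => a) => apply: comp_id
      | |- computable fst => exact (comp_fst (comp_id _))
      | |- computable enc => exact (comp_enc (comp_id _))
      | |- computable unpair_nat => exact (comp_unpair_nat (comp_id _))
      | |- computable snd => exact (comp_snd (comp_id _))
      | |- computable (fun a => _.1) => apply: comp_fst
      | |- computable (fun a => _.2) => apply: comp_snd
      | |- computable (fun a => (_, _)) => apply: comp_pair
      | |- computable (fun a => pair_nat _ _) => apply: comp_pair_nat
      | |- computable (fun a => unpair_nat _) => apply: comp_unpair_nat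
      | |- computable (fun a => enc _) => apply: comp_enc
      | |- computable (fun a => dec _) => apply: comp_dec
      | |- computable (fun a => _.+1) => apply: comp_succ
      | |- computable (fun a => _.-1) => apply: comp_pred
      | |- computable (fun a => _ + _) => apply: comp_add
      | |- computable (fun a => _ - _) => apply: comp_sub
      | |- computable (fun a => _ * _) => apply: comp_mul
      | |- computable (fun a => _.*2) => apply: comp_double
      | |- computable (fun a => _./2) => apply: comp_half
      | |- computable (fun a => nat_of_bool _) => apply: comp_nat_of_bool
      | |- computable (fun a => if _ then _ else _) => apply: comp_if
      | |- computable (fun a => _ :: _) => apply: comp_cons
      | |- computable (fun a => iteri _ _ _) => apply: comp_iteri
      | |- computable (fun a => iter _ _ _) => apply: comp_iter
      | |- computable (fun a => foldl _ _ _) => apply: comp_foldl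
      | |- decidable_pred (fun a => _) => apply: dec_const
      | |- computable (fun a => _) => apply: comp_const
      end
    | progress cbn beta ].

Ltac computability := computability_with fail.

Lemma comp_catrev (A T : codedType) (s t : A -> seq T) :
  computable s -> computable t -> computable (fun a => catrev (s a) (t a)).
Proof.
move=> cs ct; apply: (@comp_ext _ _ (fun a =>
  foldl (fun r x => x :: r) (t a) (s a))); last by computability.
by move=> a; elim: (s a) (t a) => //= x r IHr u; rewrite IHr.
Qed.

Lemma comp_rev (A T : codedType) (s : A -> seq T) :
  computable s -> computable (fun a => rev (s a)).
Proof. by move=> cs; apply: comp_catrev => //; apply: comp_const. Qed.

Lemma comp_foldr (A B T : codedType) (s : A -> seq T) (g : A -> B)
    (h : A -> T -> B -> B) :
  computable s -> computable g ->
  computable (fun p : A * (B * T) => h p.1 p.2.2 p.2.1) ->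
  computable (fun a => foldr (h a) (g a) (s a)).
Proof.
move=> cs cg ch; apply: (@comp_ext _ _ (fun a =>
  foldl (fun b x => h a x b) (g a) (rev (s a)))).
  by move=> a; rewrite foldl_rev.
by apply: comp_foldl => //; apply: comp_rev.
Qed.

Lemma comp_cat (A T : codedType) (s t : A -> seq T) :
  computable s -> computable t -> computable (fun a => s a ++ t a).
Proof.
move=> cs ct; apply: (@comp_ext _ _ (fun a => catrev (rev (s a)) (t a))).
  by move=> a; rewrite catrevE revK.
by apply: comp_catrev => //; apply: comp_rev.
Qed.

Lemma comp_map (A T U : codedType) (s : A -> seq T) (h : A -> T -> U) :
  computable s -> computable (fun p : A * T => h p.1 p.2) ->
  computable (fun a => map (h a) (s a)).
Proof.
move=> cs ch; apply: (@comp_ext _ _ (fun a =>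
  foldr (fun x r => h a x :: r) [::] (s a))) => //.

apply: comp_foldr => //; first exact: comp_const.
by computability_with ltac:(apply: (comp_app2 (h := h) ch)).
Qed.

Lemma comp_flatten (A T : codedType) (s : A -> seq (seq T)) :
  computable s -> computable (fun a => flatten (s a)).
Proof.
move=> cs; apply: (comp_foldr (h := fun _ => cat)) => //;
  first exact: comp_const.
by apply: comp_cat; computability.
Qed.

Lemma comp_size (A T : codedType) (s : A -> seq T) :
  computable s -> computable (fun a => size (s a)).
Proof.
move=> cs; apply: (@comp_ext _ _ (fun a => foldr (fun _ n => n.+1) 0 (s a))) =>
  //.
by apply: comp_foldr; computability.
Qed.

Lemma comp_drop (A T : codedType) (n : A -> nat) (s : A -> seq T) :
  computable n -> computable s -> computable (fun a => drop (n a) (s a)).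
Proof.
move=> cn cs; apply: (@comp_ext _ _ (fun a => iter (n a) behead (s a))).
  move=> a; elim: (n a) (s a) => [|k IHk] [|x r]; rewrite ?drop0 // iterSr /=.
    by rewrite IHk.
  exact: IHk.
apply: comp_iter => //.
apply: (@comp_case_seq _ _ _ (fun p => p.2) (fun=> [::]) (fun _ _ r => r));
  by computability.
Qed.

Lemma comp_nth (A T : codedType) (x0 : A -> T) (s : A -> seq T) (n : A -> nat) :
  computable x0 -> computable s -> computable n ->
  computable (fun a => nth (x0 a) (s a) (n a)).
Proof.
move=> c0 cs cn; apply: (@comp_ext _ _ (fun a =>
  if drop (n a) (s a) is x :: r then x else x0 a)).
  move=> a; elim: (s a) (n a) => [|x r IHr] [|k] //=; exact: IHr.
apply: (@comp_case_seq _ _ _ (fun a => drop (n a) (s a)) x0 (fun _ x _ => x));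
  by computability; apply: comp_drop.
Qed.

Lemma comp_iota (A : codedType) (n : A -> nat) :
  computable n -> computable (fun a => iota 0 (n a)).
Proof.
move=> cn; apply: (@comp_ext _ _ (fun a => iteri (n a) (fun k s =>
  rcons s k) [::])).
  by move=> a; elim: (n a) => // k IHk; rewrite iteriS IHk -addn1 iotaD cats1.
apply: comp_iteri; computability.
apply: (@comp_ext _ _ (fun p : A * (nat * seq nat) => p.2.2 ++ [:: p.2.1])).
  by move=> p; rewrite cats1.
by apply: comp_cat; computability.
Qed.

Lemma dec_has (A T : codedType) (P : A -> T -> bool) (s : A -> seq T) :
  decidable_pred (fun p : A * T => P p.1 p.2) -> computable s ->
  decidable_pred (fun a => has (P a) (s a)).
Proof.
(* The finite type [bool] has no bijective code, so the accumulator is the number 0 or 1. *)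
move=> dP cs; apply: (@comp_ext _ _ (fun a =>
  foldr (fun x b => (P a x || (b == 1)) : nat) 0 (s a))).
  by move=> a; elim: (s a) => //= x r ->; case: (P a x); case: (has _ _).
apply: comp_foldr => //; first exact: comp_const.
by computability_with ltac:(apply: (dec_app2 (h := P) dP)).
Qed.

Lemma dec_all (A T : codedType) (P : A -> T -> bool) (s : A -> seq T) :
  decidable_pred (fun p : A * T => P p.1 p.2) -> computable s ->
  decidable_pred (fun a => all (P a) (s a)).
Proof.
move=> dP cs; apply: (@dec_ext _ (fun a => ~~ has (fun x => ~~ P a x) (s a))).
  by move=> a; rewrite -all_predC; apply: eq_all => x /=; rewrite negbK.
by apply/dec_neg/dec_has => //; apply: dec_neg.
Qed.

Lemma dec_mem (A T : codedType) (x : A -> T) (s : A -> seq T) :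
  computable x -> computable s -> decidable_pred (fun a => x a \in s a).
Proof.
move=> cx cs; apply: (@dec_ext _ (fun a => has (fun y => y == x a) (s a))).
  by move=> a; rewrite has_pred1.
by apply: dec_has; computability_with ltac:(apply: (comp_comp cx)).
Qed.

Lemma dec_Delta (A : codedType) (m x : A -> nat) :
  computable m -> computable x -> decidable_pred (fun a => Delta (m a) (x a)).
Proof.
move=> cm cx; apply: (@dec_ext _ (fun a => odd (iter (x a) half (m a)))).
  move=> a; rewrite /Delta; congr odd; elim: (x a) => [|k /= ->].
    by rewrite divn1.
  by rewrite -divn2 -divnMA expnSr.
by computability.
Qed.

(** * Semidecidable predicates *)

(** The number [t] is a stage at which [a] is accepted. With a decidable test for each stage, the
    condition that no stage up to a bound accepts is decidable too, as the diagonal argument in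
    [ex_fp_witness] requires. *)
Definition semidec (A : codedType) (P : A -> Prop) : Prop :=
  exists2 f : A * nat -> bool, decidable_pred f & forall a, P a <-> exists t, f
    (a, t).

Lemma sd_iff (A : codedType) (P Q : A -> Prop) :
  (forall a, P a <-> Q a) -> semidec P -> semidec Q.
Proof. by move=> PQ [f df fP]; exists f => // a; rewrite -PQ. Qed.

Lemma sd_comp (A B : codedType) (P : B -> Prop) (f : A -> B) :
  semidec P -> computable f -> semidec (fun a => P (f a)).
Proof.
move=> [g dg gP] cf; exists (fun p => g (f p.1, p.2)) => [|a]; last exact: gP.
apply: (comp_comp dg); apply: comp_pair; computability.
exact/(comp_comp cf)/comp_fst/comp_id.
Qed.

Lemma sd_dec (A : codedType) (P : A -> bool) : decidable_pred P -> semidec P.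
Proof.
move=> dP; exists (fun p => P p.1) => [|a]; last by split=> [|[]//]; exists 0.
exact/(comp_comp dP)/comp_fst/comp_id.
Qed.

Lemma sd_eq (A B : codedType) (f g : A -> B) :
  computable f -> computable g -> semidec (fun a => f a = g a).
Proof.
move=> cf cg; apply: (@sd_iff _ (fun a => f a == g a)).
  by move=> a; split=> /eqP.
exact/sd_dec/dec_eq.
Qed.

(** Dovetailing: one stage codes a candidate together with a stage for it. *)
Lemma sd_ex (A B : codedType) (P : A -> B -> Prop) :
  semidec (fun p : A * B => P p.1 p.2) -> semidec (fun a => exists b, P a b).
Proof.
move=> [f df fP].
pose d : nat -> B * nat := dec.
exists (fun p => f ((p.1, (d p.2).1), (d p.2).2)).
  by apply: (comp_comp df); rewrite /d; computability.
move=> a; split=> [[b Pab]|[t ft]].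
  have [t ft] := (fP (a, b)).1 Pab; have [k Ek] : exists k, d k = (b, t).
    by exists (enc (b, t)); apply: encK.
  by exists k; rewrite -[f _]/(f ((a, (d k).1), (d k).2)) Ek.
by exists (d t).1; apply/(fP (a, _)); exists (d t).2.
Qed.

Lemma sd_and (A : codedType) (P Q : A -> Prop) :
  semidec P -> semidec Q -> semidec (fun a => P a /\ Q a).
Proof.
move=> [f df fP] [g dg gP].
apply: (@sd_iff _ (fun a => exists q : nat * nat, f (a, q.1) && g (a, q.2))).
  move=> a; rewrite fP gP; split=> [[q /andP[]]|[[t ft] [u gu]]]; first eauto.
  by exists (t, u); rewrite ft.
apply/sd_ex/sd_dec/dec_and.
  by apply: (comp_comp df); computability.
by apply: (comp_comp dg); computability.
Qed.

Lemma sd_or (A : codedType) (P Q : A -> Prop) :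
  semidec P -> semidec Q -> semidec (fun a => P a \/ Q a).
Proof.
move=> [f df fP] [g dg gP]; exists (fun p => f p || g p).
  exact: dec_or.
move=> a; rewrite fP gP; split=> [[] [t]|[t /orP[]]]; try by eauto.
- by exists t; apply/orP; left.
- by exists t; apply/orP; right.
Qed.

(** A stage is a common strict bound on acceptance stages for the finitely many entries. *)
Lemma sd_all (A B : codedType) (P : A -> B -> Prop) (s : A -> seq B) :
  semidec (fun p : A * B => P p.1 p.2) -> computable s ->
  semidec (fun a => forall b, b \in s a -> P a b).
Proof.
move=> [f df fP] cs.
pose g p := all (fun b => has (fun t => f ((p.1, b), t)) (iota 0 p.2)) (s p.1).
exists g.
  apply: dec_all; last exact/(comp_comp cs)/comp_fst/comp_id.
  apply: dec_has; last by apply/comp_iota; computability.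
  by apply: (comp_comp df); computability.
move=> a; rewrite /g /=; split=> [|[T /allP Tf] b /Tf /hasP[t _ ft]];
  last first.
  by apply/(fP (a, b)); exists t.
elim: (s a) => [|b r IHr] Pr; first by exists 0.
have [|T /allP TP] := IHr; first by move=> c cr; apply: Pr; rewrite inE cr orbT.
have [t ft] := (fP (a, b)).1 (Pr b (mem_head _ _)).
exists (maxn T t.+1) => /=; apply/andP; split.
  by apply/hasP; exists t => //; rewrite mem_iota; lia.
apply/allP => c /TP/hasP[u]; rewrite mem_iota => ltu fu.
by apply/hasP; exists u => //; rewrite mem_iota; lia.
Qed.

Lemma sd_all_lt (A : codedType) (P : A -> nat -> Prop) (n : A -> nat) :
  semidec (fun p : A * nat => P p.1 p.2) -> computable n ->
  semidec (fun a => forall k, k < n a -> P a k).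
Proof.
move=> sP cn; apply: (sd_iff _ (sd_all sP (comp_iota cn))) => a.
by split=> aP k; have := aP k; rewrite mem_iota add0n.
Qed.

Ltac semidecidability_with base :=
  repeat first
    [ base
    | lazymatch goal with
      | |- semidec (fun a => exists b, _) => apply: sd_ex
      | |- semidec (fun a => _ /\ _) => apply: sd_and
      | |- semidec (fun a => _ \/ _) => apply: sd_or
      | |- semidec (fun a => forall k : nat, is_true (k < _) -> _) =>
          apply: sd_all_lt
      | |- semidec (fun a => forall b, is_true (b \in _) -> _) => apply: sd_all
      | |- semidec (fun a => is_true _) => apply: sd_dec
      | |- semidec (fun a => _ = _) => apply: sd_eq
      | |- decidable_pred (fun a => _ \in _) => apply: dec_mem
      end
    | progress cbn beta
    | progress computability ].

Ltac semidecidability := semidecidability_with fail.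

(** * Derivability and the universal machine *)

(** Closure under rules with finitely many premises. Evaluation ([eval_rule]) and triviality of
    words ([triv_rule]) both take this form, and [sd_derivable] makes both semidecidable. *)
Inductive derivable (A : eqType) (rule : seq A -> A -> Prop) : A -> Prop :=
  | derive l a : (forall b, b \in l -> derivable rule b) -> rule l a ->
      derivable rule a.

Section Traces.
Variables (A : eqType) (rule : seq A -> A -> Prop).

(** A derivation laid out as a list, most recent conclusion first, so that premises are found in the
    tail. *)
Fixpoint trace (s : seq A) : Prop :=
  if s is a :: r
  then (exists2 l, rule l a & {subset l <= r}) /\ trace r
  else True.

Lemma trace_cat s t : trace s -> trace t -> trace (s ++ t).
Proof.
elim: s => //= a r IHr [[l la lr] tr] tt; split; last exact: IHr.
by exists l => // b /lr br; rewrite mem_cat br.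
Qed.

Lemma derivable_trace a : derivable rule a <->
  exists2 s : seq A, trace s & a \in s.
Proof.
split=> [|[s]]; last first.
  elim: s a => //= b r IHr a [[l lb lr] tr]; rewrite inE => /orP[/eqP-> |];
    last exact: IHr.
  by apply: derive lb => c /lr; apply: IHr.
elim=> l {}a _ IHl la.
have [s ts ls] : exists2 s, trace s & {subset l <= s}.
  elim: l IHl {la} => [|b l IHl] tl; first by exists [::].
  have [|s ts ls] := IHl; first by move=> c cl; apply: tl; rewrite inE cl orbT.
  have [|t tt bt] := tl b; first exact: mem_head.
  exists (t ++ s); first exact: trace_cat.
  by move=> c; rewrite inE mem_cat => /orP[/eqP->|/ls->]; rewrite ?bt ?orbT.
by exists (a :: s); [split=> //; exists l | apply: mem_head].
Qed.

(** Bounded quantifiers replace the recursion, which is the shape treated by [semidecidability]. The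
    default [a0] is never read, as [k < size s]. *)
Lemma traceP a0 s : trace s <-> forall k, k < size s ->
  exists l, rule l (nth a0 s k) /\ forall b, b \in l -> b \in drop k.+1 s.
Proof.
elim: s => [|a r IHr] //=; rewrite IHr; split=> [[[l la lr] rP] [_|k /rP//]|rP].
  by exists l; rewrite drop0.
split=> [|k]; last exact: (rP k.+1).
by have [|l []] := rP 0; rewrite //= drop0; exists l.
Qed.

End Traces.

(** Search for a trace containing the conclusion. The parameter in [C] keeps the procedure uniform,
    for instance in the presentation whose word problem is considered. *)
Lemma sd_derivable (C A : codedType) (rule : C -> seq A -> A -> Prop) :
  semidec (fun p : C * (seq A * A) => rule p.1 p.2.1 p.2.2) ->
  semidec (fun p : C * A => derivable (rule p.1) p.2).
Proof.
move=> sd_rule; apply: (@sd_iff _ (fun p : C * A => exists s : seq A,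
    p.2 \in s /\ forall k, k < size s -> exists l,
      rule p.1 l (nth p.2 s k) /\ forall b, b \in l -> b \in drop k.+1 s)).
  move=> p; rewrite derivable_trace.
  split=> [[s [ps ts]]|[s ts ps]]; exists s => //; first exact/(traceP _ p.2).
  by split=> //; apply/traceP.
semidecidability_with ltac:(first [apply: comp_size | apply: comp_drop |
  apply: (sd_comp (f := fun a => (_, (_, _))) sd_rule) | apply: comp_nth]).
Qed.

(* The triple [(i, (x, y))] asserts [phi i x y]. *)
Definition eval_rule (l : seq (nat * (nat * nat))) (t : nat * (nat * nat)) :
    Prop :=
  let i := t.1 in let x := t.2.1 in let y := t.2.2 in
  i = 0 /\ y = 0 \/ i = 1 /\ y = x.+1 \/ i = 2 /\ y = (unpair_nat x).1 \/
  i = 3 /\ y = (unpair_nat x).2 \/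
  (exists f g a b, i = (4 * pair_nat f g).+4 /\ y = pair_nat a b /\
     (f, (x, a)) \in l /\ (g, (x, b)) \in l) \/
  (exists f g z, i = (4 * pair_nat f g).+4.+1 /\
     (g, (x, z)) \in l /\ (f, (z, y)) \in l) \/
  (exists f g a, i = (4 * pair_nat f g).+4.+2 /\
     ((x = pair_nat a 0 /\ (f, (a, y)) \in l) \/
      exists n z, x = pair_nat a n.+1 /\ (i, (pair_nat a n, z)) \in l /\
        (g, (pair_nat a (pair_nat n z), y)) \in l)) \/
  (exists f, i = (4 * f).+4.+3 /\ (f, (pair_nat x y, 0)) \in l /\
     forall z, z < y -> exists v, (f, (pair_nat x z, v.+1)) \in l).

Lemma sd_eval_rule :
  semidec (fun p : nat * (seq _ * _) => eval_rule p.2.1 p.2.2).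
Proof. by rewrite /eval_rule; cbn zeta; semidecidability. Qed.

Lemma rec_eval_prec0 f g a y :
  rec_eval (RPrec f g) (pair_nat a 0) y = rec_eval f a y.
Proof. by cbn [rec_eval]; rewrite pair_natK. Qed.

Lemma rec_eval_precS f g a n y :
  rec_eval (RPrec f g) (pair_nat a n.+1) y =
  exists2 z, rec_eval (RPrec f g) (pair_nat a n) z &
             rec_eval g (pair_nat a (pair_nat n z)) y.
Proof. by cbn [rec_eval]; rewrite !pair_natK. Qed.

Lemma eval_ruleP t : derivable eval_rule t <-> phi t.1 t.2.1 t.2.2.
Proof.
split.
  elim=> l {}t _ IHl; move: t => [i [x y]] ; rewrite /eval_rule /=.
  have phil j u v : (j, (u, v)) \in l ->
    exists2 c, goedel c = j & rec_eval c u v.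
    by move/IHl.
  case=> [[-> ->]|]; first by exists RZero.
  case=> [[-> ->]|]; first by exists RSucc.
  case=> [[-> ->]|]; first by exists RFst.
  case=> [[-> ->]|]; first by exists RSnd.
  case=> [[f [g [a [b [-> [-> [/phil[c <- ca] /phil[d <- db]]]]]]]]|].
    by exists (RPair c d) => //; exists a, b.
  case=> [[f [g [z [-> [/phil[d <- dz] /phil[c <- cy]]]]]]|].
    by exists (RComp c d) => //; exists z.
  case=> [[f [g [a [iE [[-> /phil[c fE cy]]|]]]]]|].
    (* At recursion depth 0 the derivation says nothing about [g], but every number is the index of
       some code. *)
    have [d gE] := goedel_surj g.
    by exists (RPrec c d); rewrite ?iE -?fE -?gE // rec_eval_prec0.
  move=> [n [z [-> [/phil[e eE ez] /phil[d gE dy]]]]].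
    have [c fE] := goedel_surj f.
    (* The premise about the index [i] itself supplies some code [e]; injectivity of [goedel]
       identifies it with [RPrec c d]. *)
    rewrite iE -fE -gE -[X in goedel e = X]/(goedel (RPrec c d)) in eE.
    rewrite (goedel_inj eE) in ez.
    exists (RPrec c d); first by rewrite iE -fE -gE.
    by rewrite rec_eval_precS; exists z.
  case=> [f [-> [/phil[c <- c0] cS]]]; exists (RMu c) => //=;
    split=> // z /cS[v].
  by move/phil=> [d /goedel_inj<- dz]; exists v.
move: t => [i [x y]] /= [c <-];
  elim: c x y => [||||f IHf g IHg|f IHf g IHg|f IHf g IHg|f IHf] x y.
- by move=> ->; apply: (@derive _ eval_rule [::]) => //; left.
- by move=> ->; apply: (@derive _ eval_rule [::]) => //; right; left.
- by move=> ->; apply: (@derive _ eval_rule [::]) => //; do 2!right; left.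
- by move=> ->; apply: (@derive _ eval_rule [::]) => //; do 3!right; left.
- move=> [a [b [/IHf fa /IHg gb ->]]].
  apply: (@derive _ eval_rule [:: (goedel f, (x, a)); (goedel g, (x, b))]).
    by move=> t; rewrite !inE => /orP[]/eqP->.
  do 4!right; left; exists (goedel f), (goedel g), a, b.
  by rewrite !inE !eqxx orbT.
- move=> [z /IHg gz /IHf fy].
  apply: (@derive _ eval_rule [:: (goedel f, (z, y)); (goedel g, (x, z))]).
    by move=> t; rewrite !inE => /orP[]/eqP->.
  do 5!right; left; exists (goedel f), (goedel g), z.
  by rewrite !inE !eqxx orbT.
- rewrite -[x]unpair_natK; move: (unpair_nat x).1 => a.
  elim: (unpair_nat x).2 y => [|n IHn] y.
    rewrite rec_eval_prec0 => /IHf fy;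
      apply: (@derive _ eval_rule [:: (goedel f, (a, y))]).
      by move=> t; rewrite !inE => /eqP->.
    do 6!right; left; exists (goedel f), (goedel g), a; split=> //; left.
    by rewrite !inE !eqxx.
  rewrite rec_eval_precS => -[z /IHn nz /IHg gy].
  apply: (@derive _ eval_rule [:: (goedel (RPrec f g), (pair_nat a n, z));
     (goedel g, (pair_nat a (pair_nat n z), y))]).
    by move=> t; rewrite !inE => /orP[]/eqP->.
  do 6!right; left; exists (goedel f), (goedel g), a; split=> //; right.
  by exists n, z; rewrite !inE !eqxx orbT.
- move=> [/IHf f0 fS].
  (* The nonzero values at all arguments below [y] are gathered into a single list of premises. *)
  have [l lP lS] : exists2 l : seq (nat * (nat * nat)),
      forall t, t \in l -> derivable eval_rule t &
      forall z, z < y -> exists v, (goedel f, (pair_nat x z, v.+1)) \in l.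
    elim: y fS {f0} => [|y IHy] fS; first by exists [::].
    have [|l lP lS] := IHy; first by move=> z lezy; apply/fS/ltnW.
    have [v /IHf fv] := fS y (ltnSn y).
    exists ((goedel f, (pair_nat x y, v.+1)) :: l).
      by move=> t; rewrite inE => /orP[/eqP->|/lP].
    move=> z; rewrite ltnS leq_eqVlt => /orP[/eqP->|/lS[u ul]].
      by exists v; rewrite mem_head.
    by exists u; rewrite inE ul orbT.
  apply: (@derive _ eval_rule ((goedel f, (pair_nat x y, 0)) :: l)).
    by move=> t; rewrite inE => /orP[/eqP->|/lP].
  do 7!right; exists (goedel f); split=> //; split; first exact: mem_head.
  by move=> z /lS[v vl]; exists v; rewrite inE vl orbT.
Qed.

(** The universal machine: it searches for a value and a derivation of it, uniformly in the
    index. *)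
Lemma sd_W (A : codedType) (i x : A -> nat) :
  computable i -> computable x -> semidec (fun a => W (i a) (x a)).
Proof.
move=> ci cx.
apply: (@sd_iff _ (fun a => exists y, derivable eval_rule (i a, (x a, y)))).
  by move=> a; split=> -[y /(eval_ruleP (i a, (x a, y))) iy]; exists y.
apply: sd_ex; apply: (sd_comp (P := fun q : nat * _ => derivable eval_rule q.2)
  (f := fun p : A * nat => (0, (i p.1, (x p.1, p.2))))).
  exact: (sd_derivable (rule := fun=> eval_rule) sd_eval_rule).
by computability_with ltac:(first [apply: (comp_comp ci) | apply:
  (comp_comp cx)]).
Qed.

(** * The s-m-n theorem and selection *)

Fixpoint const_code (n : nat) : rec_code :=
  if n is k.+1 then RComp RSucc (const_code k) else RZero.

Lemma const_codeP n x : rec_eval (const_code n) x n.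
Proof. by elim: n => //= n IHn; exists n. Qed.

Lemma comp_const_code (A : codedType) (n : A -> nat) :
  computable n -> computable (fun a => goedel (const_code (n a))).
Proof.
(* Each round forms the index of [RComp RSucc _]; the 1 is the index of [RSucc]. *)
move=> cn; apply: (@comp_ext _ _ (fun a =>
  iter (n a) (fun g => (4 * pair_nat 1 g).+4.+1) 0)); last by computability.
by move=> a; elim: (n a) => // k /= ->.
Qed.

(** [RMu] looks for the value 0, hence it is applied to the negation of [f]. The first clause gives
    termination, the second correctness of any output. *)
Lemma mu_code (A : codedType) (f : A * nat -> bool) :
  decidable_pred f -> exists c, forall a,
    ((exists t, f (a, t)) -> exists2 t, f (a, t) & rec_eval c (enc a) t) /\
    forall t, rec_eval c (enc a) t -> f (a, t).
Proof.
move=> /dec_neg[c cP]; exists (RMu c) => a; split=> [ex_t|t [/= ft _]].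
  case: (ex_minnP ex_t) => t ft t_min; exists t => //; split.
    by have := cP (a, t); rewrite ft.
  move=> z ltzt; exists 0; have := cP (a, z).
  by rewrite (_ : f (a, z) = false) //; apply/negbTE/negP => /t_min;
    rewrite leqNgt ltzt.
have := rec_eval_fun (cP (a, t)) ft.
by case: (f (a, t)).
Qed.

(** The index [s a] is that of one fixed search code composed with the map from x to the pair of [a]
    and x; only the constant in it varies with [a]. *)
Lemma smn (A : codedType) (P : A -> nat -> Prop) :
  semidec (fun p : A * nat => P p.1 p.2) ->
  exists2 s : A -> nat, computable s & forall a x, W (s a) x <-> P a x.
Proof.
move=> [f /mu_code[c cP] fP].
exists (fun a => goedel (RComp c (RPair (const_code (enc a)) (RPair RFst
  RSnd)))).
  rewrite /=; set k := pair_nat (goedel RFst) _; clearbody k.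
  by computability_with ltac:(apply: comp_const_code).
move=> a x; have [c1 c2] := cP (a, x); split.
  move=> [y [d /goedel_inj-> [z [u [v [/= /rec_eval_fun au xv ->]]]]]].
  rewrite (au _ (const_codeP _ _)); have -> : v = x.
    by case: xv => [? [? [-> -> ->]]]; rewrite unpair_natK.
  by move=> /c2 fy; apply/(fP (a, x)); exists y.
move=> /(fP (a, x))/c1[t _ ct]; exists t.
eexists; first by []; exists (pair_nat (enc a) x) => //.
exists (enc a), x; split=> //; first exact: const_codeP.
by do 2!eexists; split=> //; rewrite unpair_natK.
Qed.

(** Uniformisation: search for a witness paired with its stage, then project to the witness. *)
Lemma selection (A B : codedType) (Q : A -> B -> Prop) :
  semidec (fun p : A * B => Q p.1 p.2) ->
  exists e, forall a, (exists b, Q a b) ->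
    exists2 b, Q a b & phi e (enc a) (enc b).
Proof.
move=> [f df fP]; pose d : nat -> B * nat := dec.
have [|c cP] := @mu_code _ (fun p : A * nat => f ((p.1, (d p.2).1), (d p.2).2)).
  by apply: (comp_comp df); rewrite /d; computability.
exists (goedel (RComp RFst c)) => a [b] /(fP (a, b))[t ft].
have [k Ek] : exists k, d k = (b, t) by exists (enc (b, t)); apply: encK.
have [|u fu cu] := (cP a).1; first by exists k; rewrite Ek.
exists (d u).1; first by apply/(fP (a, _)); exists (d u).2.
exists (RComp RFst c) => //; exists u => //.
have Eu : pair_nat (enc (d u).1) (enc (d u).2) = u.
  exact: (@decK (B * nat)%type u).
by move: Eu => /(congr1 unpair_nat); rewrite pair_natK => /(congr1 fst).
Qed.

Lemma computable_phi (A B : codedType) (f : A -> B) :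
  computable f -> exists e, forall a, phi e (enc a) (enc (f a)).
Proof. by move=> [c cP]; exists (goedel c) => a; exists c. Qed.

(** * Words *)

(** Generator i becomes 2i and its inverse 2i + 1. Words of all ranks then live in the one coded
    type [seq nat], and the rank can be a computable parameter. *)
Definition digits n (w : word n) : seq nat := [seq l.1.*2 + l.2 | l :
  'I_n * bool <- w].

Definition digits_num (n : nat) (s : seq nat) : nat :=
  foldr (fun c t => t * n.*2 + c.+1) 0 s.

Definition digit_letter n (c : nat) : option ('I_n * bool) :=
  omap (fun i => (i, odd c)) (insub c./2).

(** Digits out of range are dropped, which keeps the map total and compatible with concatenation. *)
Definition of_digits n : seq nat -> word n := pmap (@digit_letter n).

Definition are_digits (n : nat) (s : seq nat) :
  bool := all (fun c => c < n.*2) s.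

Definition flip_digit (c : nat) : nat := if odd c then c.-1 else c.+1.

Definition inv_digits (s : seq nat) : seq nat := rev (map flip_digit s).

(** A variable beyond the end of [u] is replaced by the empty word, so that [sd_law_inst] may search
    over lists [u] of any length. *)
Definition subst_digits (u : seq (seq nat)) (s : seq nat) : seq nat :=
  flatten [seq if odd c then inv_digits (nth [::] u c./2) else nth [::] u c./2
          | c <- s].

Lemma word_num_digits n (w : word n) : word_num w = digits_num n (digits w).
Proof. by elim: w => //= l w ->. Qed.

Lemma digits_are_digits n (w : word n) : are_digits n (digits w).
Proof. by apply/allP => c /mapP[[i b] _ ->] /=; have := ltn_ord i; case: b;
  lia. Qed.

Lemma digitsK n : cancel (@digits n) (@of_digits n).
Proof.
elim=> //= -[i b] w IHw; rewrite /of_digits /= /digit_letter.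
rewrite (_ : (i.*2 + b)./2 = i) ?valK /=; last by case: b; lia.
by rewrite oddD odd_double oddb -/(of_digits n (digits w)) IHw.
Qed.

Lemma of_digitsK n s : are_digits n s -> digits (of_digits n s) = s.
Proof.
elim: s => //= c s IHs /andP[ltc /IHs Es]; rewrite /of_digits /= /digit_letter.
rewrite insubT /=; first by lia.
by move=> ltc2; rewrite -/(of_digits n s) Es; congr (_ :: _); lia.
Qed.

Lemma of_digits_cat n s t :
  of_digits n (s ++ t) = of_digits n s ++ of_digits n t.
Proof. exact: pmap_cat. Qed.

Lemma digits_cat n (u v : word n) : digits (u ++ v) = digits u ++ digits v.
Proof. exact: map_cat. Qed.

Lemma digits_inv n (w : word n) : digits (inv_word w) = inv_digits (digits w).
Proof.
rewrite /digits /inv_word /inv_digits map_rev -!map_comp; congr rev.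
by apply: eq_map => -[i b] /=; rewrite /flip_digit oddD odd_double;
  case: b => /=; lia.
Qed.

Lemma digits_subst m n (u : 'I_m -> word n) U (l : word m) :
  (forall i : 'I_m, nth [::] U i = digits (u i)) ->
  digits (subst_word u l) = subst_digits U (digits l).
Proof.
move=> uU; rewrite /subst_digits /subst_word; elim: l => //= -[i b] l IHl.
rewrite digits_cat IHl; congr (_ ++ _); rewrite oddD odd_double addFb oddb.
have -> : (i.*2 + b)./2 = i by case: b; lia.
by rewrite uU; case: b => //; rewrite digits_inv.
Qed.

Lemma comp_digits_num (A : codedType) (n : A -> nat) (s : A -> seq nat) :
  computable n -> computable s -> computable (fun a => digits_num (n a) (s a)).
Proof.
move=> cn cs; apply: (@comp_foldr A nat nat s (fun=> 0)
  (fun a c t => t * (n a).*2 + c.+1)) => //; first exact: comp_const.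
by computability_with ltac:(apply: (comp_comp cn)).
Qed.

Lemma dec_are_digits (A : codedType) (n : A -> nat) (s : A -> seq nat) :
  computable n -> computable s ->
    decidable_pred (fun a => are_digits (n a) (s a)).
Proof.
move=> cn cs; apply: dec_all => //.
by computability_with ltac:(apply: (comp_comp cn)).
Qed.

Lemma comp_flip_digit (A : codedType) (c : A -> nat) :
  computable c -> computable (fun a => flip_digit (c a)).
Proof. by move=> cc; rewrite /flip_digit; computability. Qed.

Lemma comp_inv_digits (A : codedType) (s : A -> seq nat) :
  computable s -> computable (fun a => inv_digits (s a)).
Proof.
move=> cs; apply/comp_rev/(comp_map (h := fun _ => flip_digit)) => //.
by apply: comp_flip_digit; computability.
Qed.

Lemma comp_subst_digits (A : codedType) (u : A -> seq (seq nat)) (s : A ->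
  seq nat) :
  computable u -> computable s ->
    computable (fun a => subst_digits (u a) (s a)).
Proof.
move=> cu cs; apply: comp_flatten; apply: comp_map => //.
by computability_with ltac:(first [apply: comp_inv_digits | apply: comp_nth
  | apply: (comp_comp cu)]).
Qed.

(** * The word problem of a recursive presentation, and the values of the laws *)

Definition rel_digits (n j : nat) (d : seq nat) : Prop :=
  (exists c, c < n.*2 /\ d = [:: c; flip_digit c]) \/
  (are_digits n d /\ W j (digits_num n d)).

(* Words equal to 1 are connected to the empty word by insertions and deletions
   of relators and of cancelling pairs. *)
Definition triv_rule (c : nat * nat) (l : seq (seq nat)) (s : seq nat) : Prop :=
  s = [::] \/ exists u d v, rel_digits c.1 c.2 d /\
    ((s = u ++ d ++ v /\ u ++ v \in l) \/ (s = u ++ v /\ u ++ d ++ v \in l)).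

Lemma sd_triv_rule :
  semidec (fun p : (nat * nat) * (seq (seq nat) * seq nat) =>
    triv_rule p.1 p.2.1 p.2.2).
Proof.
rewrite /triv_rule /rel_digits.
by semidecidability_with ltac:(first [apply: comp_cat | apply: sd_W
  | apply: comp_flip_digit | apply: comp_digits_num | apply: dec_are_digits]).
Qed.

Lemma flip_digitK n (i : 'I_n) (b : bool) : flip_digit (i.*2 + b) = i.*2 + ~~ b.
Proof. by rewrite /flip_digit oddD odd_double; case: b => /=; lia. Qed.

Lemma triv_ruleP n j (w : word n) :
  derivable (triv_rule (n, j)) (digits w) <->
  pres_eq (fun v => W j (word_num v)) w [::].
Proof.
set R := fun v => _; set T := derivable (triv_rule (n, j)).
have relR d : rel_digits n j d -> pres_eq R (of_digits n d) [::].
  case=> [[c [ltc ->]]|[dd Wd]]; last first.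
    by apply: pres_rel; rewrite /R word_num_digits of_digitsK.
  have ltc2 : c./2 < n by lia.
  pose i := Ordinal ltc2; have -> : c = i.*2 + odd c by rewrite /=; lia.
  rewrite flip_digitK -[X in of_digits _ X]/(digits [:: (i, _);
    (i, _)]) digitsK.
  exact: pres_cancel.
(* Insertions and deletions undo each other, hence an equivalence; this takes care of the symmetry
   of [pres_eq]. *)
have relT d : rel_digits n j d -> forall u v, T (u ++ d ++ v) <-> T (u ++ v).
  move=> rd u v; split=> Tuv.
    apply: (@derive _ _ [:: u ++ d ++ v]); first by move=> s;
      rewrite inE => /eqP->.
    by right; exists u, d, v; split=> //; right; rewrite mem_head.
  apply: (@derive _ _ [:: u ++ v]); first by move=> s; rewrite inE => /eqP->.
  by right; exists u, d, v; split=> //; left; rewrite mem_head.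
split=> [|ew].
  rewrite -{2}[w]digitsK; elim=> l s _ IHl [->|[u [d [v [/relR rd]]]]].
    exact: pres_refl.
  (* The range of the digits in [u] and [v] is not tracked: [of_digits] respects concatenation on
     all lists. *)
  have cat_uv : pres_eq R (of_digits n (u ++ d ++ v)) (of_digits n (u ++ v)).
    rewrite !of_digits_cat; apply: pres_cat; first exact: pres_refl.
    by apply: (pres_cat rd); apply: pres_refl.
  case=> [[-> /IHl uv]|[-> /IHl uv]]; first exact: pres_trans uv.
  exact: pres_trans (pres_sym cat_uv) uv.
(* The arbitrary context [a], [b] is what makes the induction pass through [pres_cat]. *)
have Tw u v : pres_eq R u v ->
    forall a b, T (a ++ digits u ++ b) <-> T (a ++ digits v ++ b).
  elim=> {u v ew} [u|u v _ IH|u v x _ IHu _ IHv|u u' v v' _ IHu _ IHv|i b|r Rr]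
    a c //.
  - by rewrite IH.
  - by rewrite IHu.
  - by rewrite !digits_cat -!catA IHu [a ++ _]catA IHv -catA.
  - apply: relT; left; exists (i.*2 + b); rewrite flip_digitK; split=> //.
    by have := ltn_ord i; case: b; lia.
  - apply: relT; right; split; first exact: digits_are_digits.
    by rewrite -word_num_digits.
have := Tw _ _ ew [::] [::]; rewrite /= cats0 => ->.
by apply: (@derive _ _ [::]) => //; left.
Qed.

Lemma sd_triv (A : codedType) (n j : A -> nat) (s : A -> seq nat) :
  computable n -> computable j -> computable s ->
  semidec (fun a => derivable (triv_rule (n a, j a)) (s a)).
Proof.
move=> cn cj cs.
apply: (sd_comp (f := fun a => ((n a, j a), s a)) (sd_derivable sd_triv_rule)).
by computability.
Qed.

(** Values of the given laws only, whereas [law_relation] takes all laws valid in the variety. An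
    enumeration of [L] enumerates these values ([sd_law_inst]), and they already force the quotient
    into the variety ([variety_pres]). *)
Definition law_inst (L : laws) n (w : word n) : Prop :=
  exists m (l : word m) (u : 'I_m -> word n), L m l /\ w = subst_word u l.

Lemma sd_law_inst (L : laws) : ce_laws L ->
  semidec (fun p : nat * nat =>
    exists w : word p.1, law_inst L w /\ word_num w = p.2).
Proof.
move=> [e eL].
apply: (@sd_iff _ (fun p : nat * nat => exists m l u,
    are_digits m l /\ all (are_digits p.1) u /\ W e (pair_nat m (digits_num m
      l)) /\
    p.2 = digits_num p.1 (subst_digits u l))); last first.
  semidecidability_with ltac:(first [apply: comp_subst_digits | apply: sd_W
    | apply: comp_digits_num | apply: dec_all | apply: dec_are_digits]).
move=> [n t] /=; split.
  move=> [m [l [u [ld [/allP ud [We ->]]]]]].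
  exists (subst_word (fun i :
    'I_m => of_digits n (nth [::] u i)) (of_digits m l)).
  split.
    exists m, (of_digits m l), (fun i => of_digits n (nth [::] u i));
      split=> //.
    by apply/eL; rewrite word_num_digits of_digitsK.
  rewrite word_num_digits (@digits_subst _ _ _ u) ?of_digitsK // => i.
  rewrite of_digitsK //; case: (ltnP i (size u)) => [ltiu|leui].
    by apply: ud; apply: mem_nth.
  by rewrite nth_default.
move=> [w [[m [l [u [/eL We ->]]]] <-]].
exists m, (digits l), [seq digits (u i) | i <- enum 'I_m].
split; first exact: digits_are_digits.
split; first by apply/allP => s /mapP[i _ ->]; apply: digits_are_digits.
rewrite -word_num_digits; split=> //.
rewrite word_num_digits; congr digits_num; apply: digits_subst => i.
by rewrite (nth_map i) ?size_enum_ord // nth_ord_enum.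
Qed.

(** * Marked groups *)

Lemma Delta_lt m x : Delta m x -> x < m.
Proof.
rewrite /Delta ltnNge; apply: contraL => lemx.
by rewrite divn_small // (leq_ltn_trans lemx) // ltn_expl.
Qed.

Lemma ex_Delta (F : nat -> bool) N :
  (forall z, F z -> z < N) -> exists m, forall z, Delta m z = F z.
Proof.
elim: N F => [|N IHN] F ltF.
  exists 0 => z; rewrite /Delta div0n /=.
  by apply/esym/negbTE/negP => /ltF.
have [m mF] := IHN (fun z => F z.+1) (fun z Fz => ltF _ Fz).
exists (F 0 + m.*2) => -[|z]; rewrite /Delta.
  by rewrite divn1 oddD odd_double addbF oddb.
by rewrite expnS divnMA divn2 half_bit_double -mF.
Qed.

Lemma ex_Delta_seq (s : seq nat) : exists m, forall z, Delta m z = (z \in s).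
Proof.
apply: (@ex_Delta _ (sumn s).+1) => z; rewrite ltnS.
by elim: s => //= x s IHs; rewrite inE => /orP[/eqP->|/IHs]; lia.
Qed.

Local Open Scope group_scope.

Lemma multiplicative1 (G H : groupType) (f : {multiplicative G -> H}) : f 1 = 1.
Proof. by apply: (mulgI (f 1)); rewrite -gmulfM !mulg1. Qed.

Lemma marked_iso_refl (G : markedGroup) : marked_iso G G.
Proof.
have idQ : marked_quotient G G by exists (idfun : {multiplicative G -> G});
  rewrite map_id.
exact: marked_quotient_antisym.
Qed.

Lemma marked_iso_trans (G H K : markedGroup) :
  marked_iso G H -> marked_iso H K -> marked_iso G K.
Proof.
move=> GH HK; apply: marked_quotient_antisym.
  by apply: marked_quotient_trans (marked_iso_quotient GH) (marked_iso_quotient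
    HK).
apply: marked_quotient_trans (marked_iso_quotient (marked_iso_sym HK)) _.
exact/marked_iso_quotient/marked_iso_sym.
Qed.

Lemma size_marking_pres n (R : word n -> Prop) : size (marking (pres R)) = n.
Proof. by rewrite size_map size_enum_ord. Qed.

Lemma eq_pres n (R R' : word n -> Prop) :
  (forall w, R w <-> R' w) -> pres R = pres R'.
Proof. by move=> RR'; congr pres; apply/funext => w; apply/propext. Qed.

(** Von Dyck's theorem. *)
Lemma marked_quotient_presP n (R : word n -> Prop) (G : markedGroup) :
  marked_quotient (pres R) G <->
  exists s : 'I_n -> G, [seq s i | i <- enum 'I_n] = marking G /\
                        forall r, R r -> word_val s r = 1.
Proof.
split=> [[f fG]|[s [sG /pres_morph[f fs]]]].
  exists (f \o pres_gen R); split; first by rewrite -fG /= -map_comp.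
  move=> r Rr; rewrite word_val_morph word_val_pres_gen -(multiplicative1 f).
  by congr (f _); apply/pres_classP/pres_rel.
by exists f; rewrite -sG /= -map_comp; apply: eq_map => i /=; rewrite fs.
Qed.

(** Reduces marked quotients to the word problem. The images of the generators are forced by the
    marking. *)
Lemma marked_quotient_pres n (R R' : word n -> Prop) :
  marked_quotient (pres R) (pres R') <-> forall r, R r -> pres_eq R' r [::].
Proof.
have genE r : word_val (pres_gen R') r = 1 <-> pres_eq R' r [::].
  by rewrite word_val_pres_gen -pres_classP.
rewrite marked_quotient_presP; split=> [[s [sE sR]] r /sR|RR'].
  have -> : s = pres_gen R'; last by move/genE.
  by apply/funext => i; move/eq_in_map: sE; apply; rewrite mem_enum.
by exists (pres_gen R'); split=> // r /RR'/genE.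
Qed.

Lemma law_inst_relation (L : laws) n (w : word n) :
  law_inst L w -> law_relation (variety L) w.
Proof. by move=> [m [l [u [Ll ->]]]]; exists m, l, u; split=> // G; apply. Qed.

Lemma law_relation_val (V : groupType -> Prop) (G : groupType) n
    (s : 'I_n -> G) (w : word n) :
  V G -> law_relation V w -> word_val s w = 1.
Proof. by move=> VG [m [l [u [Vl ->]]]]; rewrite word_val_subst; apply: Vl. Qed.

(** All elements are classes of words, so any value of a law is the class of a word in
    [law_inst]. *)
Lemma variety_pres (L : laws) n (R : word n -> Prop) :
  (forall w, law_inst L w -> R w) -> variety L (pres R).
Proof.
move=> LR m l Ll s.
have -> : s = fun i => word_val (pres_gen R) (pres_repr (s i)).
  by apply/funext => i; rewrite word_val_pres_gen pres_reprK.
rewrite -word_val_subst word_val_pres_gen; apply/pres_classP/pres_rel/LR.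
by exists m, l, (fun i => pres_repr (s i)).
Qed.

(** Here [N] is any set between [law_inst] and [law_relation]. The lower extreme gives c.e.
    relators, the upper one is the definition of finite presentations modulo the variety; both
    present the same group. *)
Lemma largest_quotient_pres (L : laws) n (R N R' : word n -> Prop) :
  (forall w, law_inst L w -> N w) ->
  (forall w, N w -> law_relation (variety L) w) ->
  (forall w, R' w <-> R w \/ N w) ->
  largest_quotient (variety L) (pres R) (pres R').
Proof.
move=> LN NL R'E; split.
- by apply: variety_pres => w /LN Nw; apply/R'E; right.
- by apply/marked_quotient_pres => r Rr; apply/pres_rel/R'E; left.
- move=> Q VQ /marked_quotient_presP[s [sQ sR]].
  apply/marked_quotient_presP; exists s; split=> // r /R'E[/sR //|/NL].
  exact: law_relation_val.
Qed.

Lemma largest_quotient_iso (V : groupType -> Prop) (G Q Q' : markedGroup) :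
  largest_quotient V G Q -> largest_quotient V G Q' -> marked_iso Q Q'.
Proof.
move=> [VQ GQ minQ] [VQ' GQ' minQ'].
by apply: marked_quotient_antisym; [apply: minQ | apply: minQ'].
Qed.

Lemma mqa_index_iso (V : groupType -> Prop) (G H : markedGroup) i :
  marked_iso G H -> mqa_index V G i -> mqa_index V H i.
Proof.
move=> isoGH; have quoGH := marked_iso_quotient isoGH.
have quoHG := marked_iso_quotient (marked_iso_sym isoGH).
rewrite /mqa_index (marked_quotient_size quoGH) => mqaG j /mqaG->.
by split; apply: marked_quotient_trans.
Qed.

Lemma mqa_indexE (V : groupType -> Prop) (G : markedGroup) n i :
  size (marking G) = n -> mqa_index V G i ->
  forall j, V (rec_pres n j) -> (W i j <-> marked_quotient G (rec_pres n j)).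
Proof. by move=> <-. Qed.

(** * Passage between finite presentations modulo the variety and quotient algorithms *)

Section Uniform.
Variables (L : laws) (hL : ce_laws L).
Let V := variety L.

(** Turns a finite presentation modulo the variety into a recursive presentation of the same marked
    group (see [largest_fp]). *)
Lemma ex_fp_index : exists2 g : nat * nat -> nat, computable g &
  forall n m (w : word n),
    W (g (n, m)) (word_num w) <-> Delta m (word_num w) \/ law_inst L w.
Proof.
have [|g cg gP] := @smn _ (fun (a : nat * nat) t =>
    Delta a.2 t \/ exists w : word a.1, law_inst L w /\ word_num w = t).
  apply: sd_or; first by apply: sd_dec; apply: dec_Delta; computability.
  apply: (sd_comp (f := fun p :
    (nat * nat) * nat => (p.1.1, p.2)) (sd_law_inst hL)).
  by computability.
exists g => // n m w; rewrite gP /=; split=> [] [|Lw]; try by left.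
  by case: Lw => v [Lv /word_num_inj <-]; right.
by right; exists w.
Qed.

(** Yields the quotient algorithm of [mqa_index_fp]. Members of [Delta m] are below [m], so a
    bounded quantifier over word problems suffices; for positive rank each of them numbers a
    word. *)
Lemma ex_quotient_index : exists2 h : nat * nat -> nat, computable h &
  forall n m j, 0 < n -> (W (h (n, m)) j <->
    forall w : word n, Delta m (word_num w) ->
      pres_eq (fun v => W j (word_num v)) w [::]).
Proof.
have [|h ch hP] := @smn _ (fun (a : nat * nat) j =>
    forall x, x < a.2 -> ~~ Delta a.2 x \/ exists s,
      are_digits a.1 s /\ digits_num a.1 s = x /\ derivable (triv_rule (a.1,
        j)) s).
  semidecidability_with ltac:(first [apply: dec_Delta | apply: sd_triv
    | apply: comp_digits_num | apply: dec_are_digits]).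
exists h => // n m j n0; rewrite hP /=; split=> [hm w mw|hm x _].
  have [|[s [sd [sw ts]]]] := hm _ (Delta_lt mw); first by rewrite mw.
  apply/triv_ruleP; suff -> : digits w = s by [].
  rewrite -(of_digitsK sd); congr digits; apply: word_num_inj.
  by rewrite [RHS]word_num_digits of_digitsK.
case: (boolP (Delta m x)) => mx; [right | by left].
have [w xE] := word_num_surj n0 x; exists (digits w).
rewrite digits_are_digits -word_num_digits xE; split=> //; split=> //.
by apply/triv_ruleP/hm; rewrite xE.
Qed.

Variable g : nat * nat -> nat.
Hypothesis gP : forall n m (w : word n),
  W (g (n, m)) (word_num w) <-> Delta m (word_num w) \/ law_inst L w.

Lemma largest_fp n m :
  largest_quotient V (fin_pres n m) (rec_pres n (g (n, m))).
Proof.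
by apply: (largest_quotient_pres (N := @law_inst L n)) => // w;
  apply: law_inst_relation.
Qed.

(** By the universal property, a group and its largest quotient in [V] have the same marked
    quotients in [V]. *)
Lemma mqa_index_fp n m i :
  (forall j, W i j <-> forall w : word n, Delta m (word_num w) ->
      pres_eq (fun v => W j (word_num v)) w [::]) ->
  mqa_index V (rec_pres n (g (n, m))) i.
Proof.
have [_ quo_g min_g] := largest_fp n m.
move=> iP; rewrite /mqa_index size_marking_pres => j Vj.
rewrite iP -marked_quotient_pres; split; first exact: min_g.
exact: marked_quotient_trans.
Qed.

(** The two semidecidable properties of the finite set F = [Delta m]. The bound [x < m] follows from
    [Delta m x] and makes the quantifier bounded. *)
Definition fp_witness n e i m : Prop :=
  (forall x, x < m -> Delta m x -> W e x) /\ W i (g (n, m)).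

(** Inclusion in [W e] and the universal property give a map onto [H]; acceptance by [i] gives a map
    back. *)
Lemma fp_witness_iso n e i m (H : markedGroup) :
  marked_iso (rec_pres n e) H -> V H -> mqa_index V H i ->
  fp_witness n e i m -> marked_iso (rec_pres n (g (n, m))) H.
Proof.
move=> isoH VH mqaH [me Wg]; have quoH := marked_iso_quotient isoH.
have szH : size (marking H) = n by rewrite -(marked_quotient_size quoH)
  size_marking_pres.
have [Vg quo_g min_g] := largest_fp n m.
apply: marked_quotient_antisym; last exact/(mqa_indexE szH mqaH Vg).
apply: min_g => //; apply: marked_quotient_trans quoH.
by apply/marked_quotient_pres => r mr; apply/pres_rel/me => //; apply: Delta_lt.
Qed.

Lemma ex_fp_witness n e i (H : markedGroup) :
  marked_iso (rec_pres n e) H -> V H -> mqa_index V H i ->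
  exists m, fp_witness n e i m.
Proof.
move=> isoH VH mqaH; have quoH := marked_iso_quotient isoH.
have szH : size (marking H) = n by rewrite -(marked_quotient_size quoH)
  size_marking_pres.
have mqaP := mqa_indexE szH mqaH.
have [u du uP] : semidec (fun p : nat * nat => W p.1 p.2) by apply: sd_W;
  computability.
(* The element [z] enters [W e] at stage [s], and no stage up to [z + s] shows [x] in [W x]. Having
   [z] in this bound makes [F x] finite as soon as [x] lies in [W x]. *)
pose F x z := exists s, u ((e, z), s) /\
  forall t, t < (z + s).+1 -> ~~ u ((x, x), t).
have [|f cf fP] := @smn _ (fun x z =>
    F x z \/ exists w : word n, law_inst L w /\ word_num w = z).
  apply: sd_or; last first.
    apply: (sd_comp (f := fun p : nat * nat => (n, p.2)) (sd_law_inst hL)).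
    by computability.
  rewrite /F; semidecidability; apply: (comp_comp du); computability.
(* The s-m-n lemma with a constant parameter provides an index of the set of [x] with [f x] in
   [W i]. *)
have [|d0 _ dP] := @smn nat (fun _ x => W i (f x)).
  by apply: sd_W; computability_with ltac:(apply: (comp_comp cf)).
pose d := d0 0.
have Vf : V (rec_pres n (f d)).
  by apply: variety_pres => w Lw; apply/fP; right; exists w.
have Wd : W d d.
  (* Otherwise no stage blocks any element of [W e], so [f d] presents a marked quotient of [H],
     which [i] accepts; by the choice of [d] this puts [d] in [W d]. *)
  apply: contrapT => nWd; apply: (nWd); apply/dP/(mqaP _ Vf).
  apply: marked_quotient_trans (marked_iso_quotient (marked_iso_sym isoH)) _.
  apply/marked_quotient_pres => r /(uP (_, _))[s us]; apply/pres_rel/fP; left.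
  by exists s; split=> // t _; apply/negP => ut; apply/nWd/(uP (_, _));
    exists t.
have [t0 ut0] := (uP (d, d)).1 Wd.
(* For members [z] of [F d] with stage [s], [z + s] lies below any stage [t0] that shows [d] in
   [W d]. *)
have [|m mF] := @ex_Delta (fun z => `[< F d z >]) t0.
  move=> z /asboolP[s [_ dN]]; rewrite ltnNge; apply/negP => le_t0.
  by have := dN t0; rewrite ut0 => /(_ _)/negP; apply; lia.
exists m; split=> [x _|].
  by rewrite mF => /asboolP[s [us _]]; apply/(uP (_, _)); exists s.
have [Vg _ _] := largest_fp n m; apply/(mqaP _ Vg).
suff <- : rec_pres n (f d) = rec_pres n (g (n, m)) by apply/(mqaP _ Vf)/(dP 0).
apply: eq_pres => w; rewrite gP fP mF; split=> [] [|Lw].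
- by move=> Fw; left; apply/asboolP.
- by case: Lw => v [Lv /word_num_inj <-]; right.
- by move=> /asboolP; left.
- by right; exists w.
Qed.

End Uniform.

(** The conjunction takes its value from its first component, hence an equality. The group that
    [nu_MQA] chooses is isomorphic to it by [mqa_graph_unique]. *)
Lemma conj_value (L : laws) n j i :
  0 < n -> variety L (rec_pres n j) -> mqa_index (variety L) (rec_pres n j) i ->
  exists hq : dom (sub_conj nu_RP (nu_MQA (variety L)))
                  (pair_nat (pair_nat n j) (pair_nat n i)),
    nu_val hq = rec_pres n j.
Proof.
move=> n0 Vj mqaj; set r := pair_nat _ _.
have graph_r : mqa_graph (variety L) (unpair_nat r).2 (rec_pres n j).
  rewrite /r !pair_natK; split=> //=; last 2 first.
  - by rewrite pair_natK; apply: size_marking_pres.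
  - by rewrite pair_natK.
  have hp : dom nu_RP (pair_nat n j) by rewrite /= pair_natK.
  by exists (pair_nat n j), hp; rewrite /= pair_natK; apply: marked_iso_refl.
have hp : dom nu_RP (unpair_nat r).1 by rewrite /r /= !pair_natK.
have Ehp : nu_val hp = rec_pres n j by rewrite /r /= !pair_natK.
have hq : dom (nu_MQA (variety L)) (unpair_nat r).2 by exists (rec_pres n j).
have hr : dom (sub_conj nu_RP (nu_MQA (variety L))) r.
  exists hp, hq; rewrite Ehp; apply: mqa_graph_unique graph_r _.
  exact: (projT2 (cid hq)).
by exists hr; rewrite -Ehp.
Qed.

Theorem proposition53 (L : laws) (hL : ce_laws L) :
  (forall H : markedGroup, rec_presented H -> variety L H ->
     (has_mqa (variety L) H <-> fin_presented_mod (variety L) H)) /\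
  sub_equiv (nu_FP L) (sub_conj nu_RP (nu_MQA (variety L))).
Proof.
have [g cg gP] := ex_fp_index hL; have [h ch hP] := ex_quotient_index.
split=> [H [p [/= n0 isoH]] VH|].
  set n := (unpair_nat p).1 in n0 isoH; split=> [[i mqaH]|[k [R isoR]]].
    have [m wm] := ex_fp_witness hL gP isoH VH mqaH.
    have iso_m := fp_witness_iso gP isoH VH mqaH wm.
    pose wd t := projT1 (cid (word_num_surj n0 t)).
    have wdK t : word_num (wd t) = t by rewrite /wd; case: cid.
    exists n, [seq wd t | t <- iota 0 m & Delta m t].
    (* Both presentations give the largest quotient of the same finite presentation, one through
       [law_relation] and the other through [law_inst]. *)
    apply: marked_iso_trans iso_m;
      apply: largest_quotient_iso (largest_fp gP n m).
    apply: (@largest_quotient_pres L n _ (@law_relation (variety L) n)) => // w.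
      exact: law_inst_relation.
    split=> [] [|Lw]; try by right.
      by move=> /mapP[t]; rewrite mem_filter => /andP[mt _] ->; left;
        rewrite wdK.
    move=> mw; left; apply/mapP; exists (word_num w).
      by rewrite mem_filter mw mem_iota Delta_lt.
    by apply: word_num_inj; rewrite wdK.
  have Ek : k = n.
    rewrite -(size_marking_pres (fun w =>
      w \in R \/ law_relation (variety L) w)).
    rewrite (marked_quotient_size (marked_iso_quotient isoR)).
    by rewrite -(marked_quotient_size (marked_iso_quotient isoH))
      size_marking_pres.
  subst k; have [m mR] := ex_Delta_seq [seq word_num w | w <- R].
  exists (h (n, m)); apply: mqa_index_iso isoR _.
  have := mqa_index_fp gP (fun j => hP n m j n0); apply: mqa_index_iso.
  apply: largest_quotient_iso (largest_fp gP n m) _.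
  apply: (@largest_quotient_pres L n _ (@law_relation (variety L) n)) => // w.
    exact: law_inst_relation.
  by rewrite mR (mem_map (@word_num_inj n)).
split.
  (* The pair of n and m goes to the presentation (n, g(n, m)) paired with the algorithm (n, h(n,
     m)). *)
  pose n p := (unpair_nat p).1;
    pose gh p := (g (unpair_nat p), h (unpair_nat p)).
  have [|e eP] := @computable_phi nat nat (fun p =>
      pair_nat (pair_nat (n p) (gh p).1) (pair_nat (n p) (gh p).2)).
    rewrite /n /gh; computability_with ltac:(first [apply: (comp_comp cg)
      | apply: (comp_comp ch)]).
  exists e => p hp.
  exists (pair_nat (pair_nat (n p) (gh p).1) (pair_nat (n p) (gh p).2)).
  have uE : unpair_nat p = (n p, (unpair_nat p).2).
    by rewrite -surjective_pairing.
  have largest_p : largest_quotient (variety L)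
      (fin_pres (n p) (unpair_nat p).2) (rec_pres (n p) (gh p).1).
    by rewrite /gh uE; apply: largest_fp.
  have [Vp _ _] := largest_p; have [|hq Eq] := conj_value (i := (gh p).2) hp Vp.
    by rewrite /gh uE; apply: mqa_index_fp => // j; apply: hP.
  exists hq; rewrite Eq; split; first exact: eP.
  by apply: largest_quotient_iso largest_p _; apply: (projT2 (cid _)).
(* The input [r] holds a presentation (n, e) and an algorithm with index i; the search is for [q]
   coding n together with a witness m. *)
pose Q r q := (unpair_nat q).1 = (unpair_nat (unpair_nat r).1).1 /\
  fp_witness g (unpair_nat (unpair_nat r).1).1 (unpair_nat (unpair_nat r).1).2
    (unpair_nat (unpair_nat r).2).2 (unpair_nat q).2.
have [|e eP] := @selection nat nat Q.
  rewrite /Q /fp_witness; apply: sd_and; first by semidecidability.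
  apply: sd_and; last first.
    by apply: sd_W; computability_with ltac:(apply: (comp_comp cg)).
  apply: sd_all_lt; last by computability.
  (* The premise [Delta m x] is decidable, so the implication becomes a disjunction. *)
  apply: (@sd_iff _ (fun p : nat * nat * nat =>
    ~~ Delta (unpair_nat p.1.2).2 p.2 \/
    W (unpair_nat (unpair_nat p.1.1).1).2 p.2)).
    by move=> p /=; case: Delta; split=> [[]|] //; [right | left]; auto.
  by semidecidability_with ltac:(first [apply: dec_Delta | apply: sd_W]).
exists e => r [hp [hq isoRM]].
have [_ VG _ mqaG] := projT2 (cid hq).
have [m wm] := ex_fp_witness hL gP isoRM VG mqaG.
have [|q [nE wq] phi_q] := eP r.
  by exists (pair_nat (unpair_nat (unpair_nat r).1).1 m); rewrite /Q pair_natK.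
have hq' : dom (nu_FP L) q by rewrite /= nE.
exists q, hq'; split=> //.
apply: (marked_iso_trans (H := projT1 (cid hq))); last exact: marked_iso_sym.
apply: marked_iso_trans (fp_witness_iso gP isoRM VG mqaG wq); rewrite -nE.
by apply: largest_quotient_iso (largest_fp gP _ _); apply: (projT2 (cid _)).
Qed.
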